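(* For every integer $k\ge 3$ there is $\gamma_0>0$ such that for every $0<\gamma<\gamma_0$ there are $\beta_0,\mu_0>0$ such that for all $0<\beta<\beta_0$ and $0<\mu<\mu_0$ there is $n_0$ such that the following holds for every $n\ge n_0$ divisible by $k$. Let $H$ be a $k$-graph on $n$ vertices with $\delta_{k-1}(H)\ge n/k$, and let $\mathcal P_0=\{V_1,\dots,V_d\}$ and $\mathcal P_0'=\{V_1',\dots,V_{d'}'\}$ be partitions of $V(H)$ such that: (i) $\mathcal P_0$ refines $\mathcal P_0'$ and $(\mathcal P_0',L_{\mathcal P_0'}^{\mu}(H))$ is a full pair for $H$; (ii) each part of $\mathcal P_0$ and of $\mathcal P_0'$ has size at least $n/k-2\gamma n$; (iii) for each $D\subseteq V(H)$ with $\mathbf i_{\mathcal P_0'}(D)\in L_{\mathcal P_0'}^{\mu}(H)$ we have $\mathbf i_{\mathcal P_0}(D)\in L_{\mathcal P_0}^{\mu}(H)$; (iv) for each $i\in[d]$, $V_i$ is $(\beta,2^{k-1})$-closed in $H$. Then $H$ contains a perfect matching if and only if the full pair $(\mathcal P_0',L_{\mathcal P_0'}^{\mu}(H))$ is soluble and $H\notin\mathcal H_{n,k}$.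
   Context: A $k$-graph $H$ has a vertex set $V(H)$ and edge set $E(H)\subseteq\binom{V(H)}{k}$; $\delta_{k-1}(H)$ is the minimum, over $(k-1)$-sets $S\subseteq V(H)$, of the number of edges containing $S$. A matching is a set of pairwise disjoint edges; $V(M)$ is the set of vertices covered by the matching $M$; $M$ is perfect if $V(M)=V(H)$. Partitions have an implicit order on their parts. For a partition $\mathcal P$ of $V=V(H)$ into $d$ parts, the index vector $\mathbf i_{\mathcal P}(S)\in\mathbb Z^d$ of $S\subseteq V$ is the vector of the sizes of the intersections of $S$ with the parts of $\mathcal P$. $\mathcal P$ refines $\mathcal P'$ if every part of $\mathcal P$ is a subset of some part of $\mathcal P'$. For $\mu>0$, $I_{\mathcal P}^{\mu}(H)$ is the set of all $\mathbf i\in\mathbb Z^d$ such that at least $\mu|V|^k$ edges $e\in H$ have $\mathbf i_{\mathcal P}(e)=\mathbf i$, and $L_{\mathcal P}^{\mu}(H)$ is the lattice (additive subgroup) of $\mathbb Z^d$ generated by $I_{\mathcal P}^{\mu}(H)$. An $r$-vector in $\mathbb Z^d$ is a vector with non-negative integer coordinates summing to $r$; $\mathbf u_j$ is the $1$-vector with $1$ in coordinate $j$. An edge-lattice is a lattice in $\mathbb Z^d$ generated by a set of $k$-vectors. A transferral is a non-zero difference $\mathbf u_i-\mathbf u_j$; a lattice is transferral-free if it contains no transferral. A set $I$ of $k$-vectors is full if for every $(k-1)$-vector $\mathbf v$ there is $i\in[d]$ with $\mathbf v+\mathbf u_i\in I$. A lattice is full if it contains a full set of $k$-vectors and is transferral-free.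 A full pair $(\mathcal P,L)$ for $H$ consists of a partition $\mathcal P$ of $V(H)$ into $d\le k$ parts and a full edge-lattice $L\subseteq\mathbb Z^d$. A (possibly empty) matching $M$ in $H$ of size at most $|\mathcal P|-1$ is a solution for $(\mathcal P,L)$ if $\mathbf i_{\mathcal P}(V(H)\setminus V(M))\in L$; $(\mathcal P,L)$ is soluble if it has a solution, and insoluble otherwise. Two vertices $u,v$ of an $n$-vertex $k$-graph $H$ are $(\beta,i)$-reachable in $H$ if there are at least $\beta n^{ik-1}$ sets $S$ of $ik-1$ vertices such that both $H[S\cup\{u\}]$ and $H[S\cup\{v\}]$ have perfect matchings. A vertex set $U$ is $(\beta,i)$-closed in $H$ if any two vertices $u,v\in U$ are $(\beta,i)$-reachable in $H$. $\mathcal H_{n,k}$ is the collection of $n$-vertex $k$-graphs $H$ for which there is a partition $V(H)=X\cup Y$ such that $n/k-|X|$ is odd and every edge of $H$ intersects $X$ in an odd number of vertices. *)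

(* Defs.v *)
From HB Require Import structures.
From mathcomp Require Import all_boot all_order all_algebra.
From mathcomp Require Import boolp classical_sets reals.

Set Implicit Arguments.
Unset Strict Implicit.
Unset Printing Implicit Defensive.

Import Order.TTheory GRing.Theory Num.Theory.
Local Open Scope ring_scope.

(** A [k]-graph is given by its edge set [H : {set {set V}}]; its vertex set is
    the whole finite type [V]. *)

Definition kgraph (V : finType) (k : nat) (H : {set {set V}}) : Prop :=
  forall e, e \in H -> #|e| = k.

Definition degree (V : finType) (H : {set {set V}}) (S : {set V}) : nat :=
  #|[set e in H | S \subset e]|.

(** The initial value [#|H|] bounds every degree, so this is the true minimum
    as soon as [V] has a [(k-1)]-subset. *)
Definition min_codegree (V : finType) (k : nat) (H : {set {set V}}) : nat :=
  \big[minn/#|H|]_(S : {set V} | #|S| == k.-1) degree H S.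

Definition matching (V : finType) (E M : {set {set V}}) : Prop :=
  M \subset E /\ finset.trivIset M.

(** [M] is a perfect matching of the hypergraph with vertex set [U] and edge
    set [E]; the vertex set covered by [M] is [finset.cover M]. *)
Definition perfect_matching (V : finType) (U : {set V}) (E M : {set {set V}})
    : Prop :=
  matching E M /\ finset.cover M = U.

Definition has_perfect_matching (V : finType) (H : {set {set V}}) : Prop :=
  exists M, perfect_matching [set: V] H M.

(** The induced hypergraph [H[U]] has vertex set [U] and edge set [H ::&: U]. *)
Definition induced_has_perfect_matching (V : finType) (H : {set {set V}})
    (U : {set V}) : Prop :=
  exists M, perfect_matching U (H ::&: U) M.

Definition ordered_partition (V : finType) (d : nat) (P : d.-tuple {set V})
    : Prop :=
  uniq P /\ finset.partition [set:: P] [set: V].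

Definition refines (V : finType) (d d' : nat)
    (P : d.-tuple {set V}) (P' : d'.-tuple {set V}) : Prop :=
  forall i : 'I_d, exists j : 'I_d', tnth P i \subset tnth P' j.

Definition index_vector (V : finType) (d : nat) (P : d.-tuple {set V})
    (S : {set V}) : 'rV[int]_d :=
  \row_(j < d) (#|S :&: tnth P j|)%:Z.

(** Subsets of [Z^d] are [classical_sets] sets of row vectors. *)

Definition robust_index_vectors (R : realType) (V : finType) (k d : nat)
    (mu : R) (P : d.-tuple {set V}) (H : {set {set V}}) : set 'rV[int]_d :=
  fun i =>
    mu * (#|V|%:R) ^+ k <= #|[set e in H | index_vector P e == i]|%:R.

Definition lattice_generated (d : nat) (I : set 'rV[int]_d)
    : set 'rV[int]_d :=
  smallest (fun G : set 'rV[int]_d => zmod_closed [in G]) I.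

Definition robust_lattice (R : realType) (V : finType) (k d : nat)
    (mu : R) (P : d.-tuple {set V}) (H : {set {set V}}) : set 'rV[int]_d :=
  lattice_generated (robust_index_vectors k mu P H).

Definition rvector (d r : nat) (v : 'rV[int]_d) : Prop :=
  (forall j, 0 <= v 0 j) /\ \sum_j v 0 j = r%:Z.

Definition unit_vector (d : nat) (j : 'I_d) : 'rV[int]_d := delta_mx 0 j.

Definition edge_lattice (d k : nat) (L : set 'rV[int]_d) : Prop :=
  exists2 I : set 'rV[int]_d,
    (forall v, I v -> rvector k v) & L = lattice_generated I.

Definition transferral (d : nat) (v : 'rV[int]_d) : Prop :=
  v != 0 /\ exists i j : 'I_d, v = unit_vector i - unit_vector j.

Definition transferral_free (d : nat) (L : set 'rV[int]_d) : Prop :=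
  forall v, transferral v -> ~ L v.

Definition full_set (d k : nat) (I : set 'rV[int]_d) : Prop :=
  (forall v, I v -> rvector k v) /\
  (forall v, rvector k.-1 v -> exists i : 'I_d, I (v + unit_vector i)).

Definition full_lattice (d k : nat) (L : set 'rV[int]_d) : Prop :=
  (exists2 I : set 'rV[int]_d, full_set k I & (forall v, I v -> L v)) /\
  transferral_free L.

Definition full_pair (V : finType) (k d : nat)
    (P : d.-tuple {set V}) (L : set 'rV[int]_d) : Prop :=
  [/\ ordered_partition P, (d <= k)%N, edge_lattice k L & full_lattice k L].

(** [#|M| < d] is [#|M| <= d - 1] without truncated subtraction. *)
Definition solution (V : finType) (d : nat) (H : {set {set V}})
    (P : d.-tuple {set V}) (L : set 'rV[int]_d) (M : {set {set V}}) : Prop :=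
  [/\ matching H M, (#|M| < d)%N & L (index_vector P (~: finset.cover M))].

Definition soluble (V : finType) (d : nat) (H : {set {set V}})
    (P : d.-tuple {set V}) (L : set 'rV[int]_d) : Prop :=
  exists M, solution H P L M.

Definition reachable (R : realType) (V : finType) (k : nat)
    (H : {set {set V}}) (beta : R) (i : nat) (u v : V) : Prop :=
  beta * (#|V|%:R) ^+ (i * k - 1) <=
    #|[set S : {set V} | [&& #|S| == (i * k - 1)%N,
         `[< induced_has_perfect_matching H (u |: S) >] &
         `[< induced_has_perfect_matching H (v |: S) >]]]|%:R.

Definition closed_in (R : realType) (V : finType) (k : nat)
    (H : {set {set V}}) (beta : R) (i : nat) (U : {set V}) : Prop :=
  forall u v, u \in U -> v \in U -> u != v -> reachable k H beta i u v.

(** The family [H_{n,k}], with [n = #|V|] and [Y] the complement of [X]. *)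
Definition parity_family (V : finType) (k : nat) (H : {set {set V}}) : Prop :=
  [/\ kgraph k H, (k %| #|V|)%N &
    exists X : {set V},
      odd (absz ((#|V| %/ k)%N%:Z - #|X|%:Z)) /\
      (forall e, e \in H -> odd #|e :&: X|)].

(* Main.v *)
Require Import Defs.
From HB Require Import structures.
From mathcomp Require Import all_boot all_order all_algebra zify ring lra.
From mathcomp Require Import boolp reals.
From mathcomp Require Import(canonicals) classical_sets.

(** Write [n = k * m], so that every [(k-1)]-set has at least [m] neighbours.

    If a perfect matching exists, deleting zero-sum subfamilies modulo the
    lattice (fullness leaves at most [d'] classes) until fewer than [d'] edges
    remain produces a solution, and counting [X] modulo 2 excludes [H_{n,k}].

    Conversely, suppose first that some set [B] with about [(k-1) * m] vertices
    contains no edge.  Up to a few exceptional vertices, the edges meeting the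
    complement [A] of [B] in exactly one vertex are then nearly complete.  One
    first takes a small matching [M] with [|A n V(M)| - |M| = |A| - m]; this is
    possible because, if edges meeting [A] twice are rare, then those meeting
    [A] three times are abundant, and only parity can be an obstruction.  The
    rest is matched by a Hall-type argument.

    Otherwise a maximum matching outside any small set misses only boundedly
    many vertices: the edges of an almost perfect matching acquire centres
    joined to many uncovered [(k-1)]-sets, and an edge avoiding all the centres
    augments the matching.  Before that one sets aside boundedly many absorbing
    layers of size at most a small multiple of [n]; they are built greedily by
    averaging, since one gadget absorbs a positive proportion of the [k]-sets not
    yet absorbed and there are only [n^k] of them.  Two further zero-sum
    deletions bring the index vector of the uncovered set [D] into the lattice;
    writing it as a bounded difference of sums of robust index vectors, the
    layers release edges for the negative part and absorb the pieces of the
    positive part. *)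

Set Implicit Arguments.
Unset Strict Implicit.
Unset Printing Implicit Defensive.

Import Order.TTheory GRing.Theory Num.Theory.

(** * Finite sets and greedy matchings *)

(** The obstacle is that fullness is known only for the lattice of the coarse partition [P'], while
    closedness, and hence absorption, is known on the parts of the finer [P]. So every zero-sum
    deletion is made modulo the lattice of [P'], hypothesis (iii) moves the resulting membership to
    the lattice of [P], and only there is it spelled out in robust index vectors. The number of
    vectors needed depends on [k] alone, because a bounded vector and a set of [k]-vectors in at
    most [k] coordinates leave finitely many cases; hence a bounded number of single-use layers
    suffices. A layer may cost a small linear share of the vertices: with [r] gadgets, [r]
    proportional to [n], the bound [(1 - c)^r * n^k] on the number of unabsorbed [k]-sets drops
    below 1, hence that number is zero, and no random choice is made. The near-perfect matching must
    tolerate the removal of that share, which is why the extremal case allows an error [s] linear in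
    [n], though small compared with [m / k^2]. *)

Lemma disjointP (V : finType) (A B : {set V}) :
  reflect (forall x, x \in A -> x \notin B) [disjoint A & B].
Proof.
by rewrite disjoint_subset; apply: (iffP subsetP) => h x /h; rewrite inE.
Qed.

(* Decides a goal [A = B], [A \subset B] or [[disjoint A & B]] from hypotheses
   of these shapes by testing an arbitrary point. *)
Ltac set_solve :=
  let x := fresh "x" in
  match goal with
  | |- is_true (subset _ _) => apply/subsetP => x; apply/implyP
  | |- is_true (disjoint _ _) => apply/disjointP => x; apply/implyP
  | |- @eq _ _ _ => apply/setP => x
  end;
  repeat match goal with
  | H : is_true (subset _ _) |- _ => move/subsetP: H => /(_ x)/implyP H
  | H : is_true (disjoint _ _) |- _ => move/disjointP: H => /(_ x)/implyP H
  | H : @eq (set_of _) _ _ |- _ => move/setP: H => /(_ x) H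
  end;
  repeat match goal with
  | H : context [in_mem x _] |- _ => move: H
  end;
  rewrite ?(in_setU, in_setI, in_setD, in_setC, in_set0, in_set1, in_setT);
  repeat match goal with
  | |- context [in_mem x ?A] => case: (in_mem x A)
  | |- context [x == ?A] => case: (x == A)
  end => //=.

Section Finite_sets.
Variable V : finType.
Implicit Types (X Y Z W S T e : {set V}) (F M E : {set {set V}}).

Lemma exists_subset_card X j : j <= #|X| -> exists2 Y : {set V}, Y \subset X & #|Y| = j.
Proof.
move=> jX; exists [set:: take j (enum X)].
  by apply/subsetP=> x; rewrite inE => /mem_take; rewrite mem_enum.
rewrite cardsE (card_uniqP _) ?take_uniq ?enum_uniq // size_take -cardE.
by case: ltngtP jX.
Qed.

Lemma cover_setU1 (e : {set V}) M : cover (e |: M) = e :|: cover M.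
Proof. by rewrite /cover bigcup_setU big_set1. Qed.

Lemma cover_setU M M' : cover (M :|: M') = cover M :|: cover M'.
Proof. by rewrite /cover bigcup_setU. Qed.

Lemma cover_set0 : cover (set0 : {set {set V}}) = set0.
Proof. by rewrite /cover big_set0. Qed.

Lemma sub_cover M (e : {set V}) : e \in M -> e \subset cover M.
Proof. by move=> eM; apply: bigcup_sup. Qed.

Lemma cover_sub M X : (forall e, e \in M -> e \subset X) -> cover M \subset X.
Proof. by move=> h; apply/bigcupsP. Qed.

Lemma cover_subset M M' : M \subset M' -> cover M \subset cover M'.
Proof. by move=> s; apply: cover_sub => e /(subsetP s); apply: sub_cover. Qed.

Lemma disjoint_cover M X :
  (forall e, e \in M -> [disjoint e & X]) -> [disjoint cover M & X].
Proof.
move=> h; rewrite disjoint_sym; apply: bigcup_disjoint => e eM.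
by rewrite disjoint_sym h.
Qed.

Lemma trivIset_set0 : trivIset (set0 : {set {set V}}).
Proof. by apply/trivIsetP=> A B; rewrite inE. Qed.

Lemma trivIset_set1 (e : {set V}) : trivIset [set e].
Proof. by apply/trivIsetP=> A B; rewrite !inE => /eqP-> /eqP->; rewrite eqxx. Qed.

Lemma trivIset_setU1 (e : {set V}) M :
  trivIset M -> [disjoint e & cover M] -> trivIset (e |: M).
Proof.
by move=> tM d; apply: trivIsetU => //; rewrite ?trivIset_set1 ?cover1.
Qed.

Lemma notin_disjoint_cover M (e : {set V}) :
  0 < #|e| -> [disjoint e & cover M] -> e \notin M.
Proof.
move=> e0 d; apply/negP=> /sub_cover s.
by move: (disjointWr s d); rewrite -setI_eq0 setIid -cards_eq0; case: #|e| e0.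
Qed.

Lemma card_cover_uniform M a :
  trivIset M -> (forall e, e \in M -> #|e| = a) -> #|cover M| = #|M| * a.
Proof.
move=> /eqP <- h; rewrite (eq_bigr (fun=> a)) ?sum_nat_const //.
Qed.

Lemma cover_setD M M' :
  trivIset M -> M' \subset M -> cover (M :\: M') = cover M :\: cover M'.
Proof.
move=> /trivIsetP tM sM; apply/eqP; rewrite eqEsubset; apply/andP; split.
  apply: cover_sub => e; rewrite inE => /andP[eM' eM].
  rewrite subsetD sub_cover //= disjoint_sym; apply: disjoint_cover => e' e'M.
  by apply: tM => //; rewrite ?(subsetP sM) //; apply: contraNneq eM' => <-.
apply/subsetP=> x; rewrite inE => /andP[xM' /bigcupP[e eM xe]].
apply/bigcupP; exists e => //; rewrite inE eM andbT.
by apply: contra xM' => /sub_cover/subsetP->.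
Qed.

Lemma disjoint_family X a N : 0 < a -> N * a <= #|X| ->
  exists F, [/\ trivIset F, #|F| = N, cover F \subset X &
    forall T, T \in F -> #|T| = a].
Proof.
move=> a0; elim: N => [|N IH] le.
  by exists set0; rewrite trivIset_set0 cards0 cover_set0 sub0set; split=> // T; rewrite inE.
have [|F [tF cF sF hF]] := IH; first by nia.
have cc : #|cover F| = N * a by rewrite (card_cover_uniform tF hF) cF.
have [|T sT cT] := @exists_subset_card (X :\: cover F) a.
  by rewrite cardsD (setIidPr sF) cc; nia.
have dT : [disjoint T & cover F] by set_solve.
exists (T |: F); split.
- exact: trivIset_setU1.
- by rewrite cardsU1 notin_disjoint_cover ?cT ?cF.
- by rewrite cover_setU1; set_solve.
- by move=> T'; rewrite !inE => /orP[/eqP->|/hF].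
Qed.

Lemma card_meeting F Z : trivIset F ->
  #|[set T in F | ~~ [disjoint T & Z]]| <= #|Z|.
Proof.
move=> tF; set F' := [set T in F | _].
have tF' : trivIset F' by apply: trivIsetS tF; apply/subsetP=> T; rewrite inE => /andP[].
have hx T : T \in F' -> exists x, (x \in T) && (x \in Z).
  rewrite inE => /andP[_]; rewrite -setI_eq0 => /set0Pn[x]; rewrite inE => h.
  by exists x.
have [->|[T0 T0F]] := set_0Vmem F'; first by rewrite cards0.
have [x0 _] := hx _ T0F.
pose f (T : {set V}) := odflt x0 [pick x | (x \in T) && (x \in Z)].
have fP T : T \in F' -> (f T \in T) && (f T \in Z).
  by move=> /hx[x hx']; rewrite /f; case: pickP => //= /(_ x); rewrite hx'.
rewrite -(card_in_imset (f := f) (D := F')); last first.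
  move=> T1 T2 h1 h2 e; apply/eqP/negPn/negP => ne.
  have := trivIsetP tF' _ _ h1 h2 ne; rewrite -setI_eq0 => /eqP/setP/(_ (f T1)).
  by rewrite !inE {2}e; case/andP: (fP _ h1) => -> _; case/andP: (fP _ h2) => -> _.
by apply: subset_leq_card; apply/subsetP=> x /imsetP[T /fP/andP[_ ?] ->].
Qed.

Lemma double_count (I J : finType) (A : {set I}) (B : {set J}) (r : I -> J -> bool) :
  \sum_(i in A) #|[set j in B | r i j]| = \sum_(j in B) #|[set i in A | r i j]|.
Proof.
transitivity (\sum_(i in A) \sum_(j in B) r i j).
  apply: eq_bigr => i _; rewrite -sum1_card big_mkcond [RHS]big_mkcond /=.
  by apply: eq_bigr => j _; rewrite !inE; case: (j \in B); case: (r i j).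
rewrite exchange_big; apply: eq_bigr => j _.
rewrite -sum1_card big_mkcond [RHS]big_mkcond /=.
by apply: eq_bigr => i _; rewrite !inE; case: (i \in A); case: (r i j).
Qed.

Lemma ex_maximum (P : pred {set {set V}}) : P set0 ->
  exists2 M, P M & forall M', P M' -> #|M'| <= #|M|.
Proof.
move=> P0; case: (@arg_maxnP _ set0 P (fun M => #|M|) P0) => M PM h.
by exists M.
Qed.

Lemma ex_maximum_matching E : (forall e, e \in E -> 0 < #|e|) ->
  exists M, [/\ M \subset E, trivIset M,
    forall M', M' \subset E -> trivIset M' -> #|M'| <= #|M| &
    forall e, e \in E -> ~~ [disjoint e & cover M]].
Proof.
move=> E0; have [|M /andP[sM tM] h] := @ex_maximum (fun M => (M \subset E) && trivIset M).
  by rewrite sub0set trivIset_set0.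
exists M; split=> // [M' s t|e eE]; first by apply: h; rewrite s.
apply/negP=> d; have := h (e |: M).
rewrite trivIset_setU1 // subUset sub1set eE sM cardsU1 notin_disjoint_cover ?E0 //.
by move=> /(_ isT); rewrite add1n ltnn.
Qed.

End Finite_sets.

Section Greedy.
Variables (V : finType) (H : {set {set V}}) (k : nat).
Hypothesis kH : kgraph k H.
Hypothesis k0 : 0 < k.
Implicit Types (X Y Z W S T e : {set V}) (F M E : {set {set V}}).

Lemma matching_card M : M \subset H -> trivIset M -> #|cover M| = #|M| * k.
Proof. by move=> sM tM; apply: card_cover_uniform tM _ => e /(subsetP sM)/kH. Qed.

(** The bound [b] has room for everything an edge may have to avoid: [W] and the edges, at most one
    per vertex of [Y], chosen for the other vertices. *)
Lemma greedy_cover b (P : pred {set V}) Y W :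
  [disjoint Y & W] -> #|W| + k * #|Y| <= b ->
  (forall y W', y \in Y -> #|W'| <= b -> y \notin W' ->
    exists e, [/\ e \in H, P e, y \in e & [disjoint e & W']]) ->
  exists M, [/\ M \subset H, trivIset M, #|M| <= #|Y|, Y \subset cover M &
    [disjoint cover M & W] /\ forall e, e \in M -> P e].
Proof.
have [n] := ubnP #|Y|; elim: n Y W => // n IH Y W leY dYW le hg.
have [->|[y yY]] := set_0Vmem Y.
  exists set0; rewrite sub0set trivIset_set0 cover_set0 cards0 sub0set.
  split=> //; split; last by move=> e; rewrite inE.
  by rewrite disjoint_subset; apply/subsetP=> x; rewrite inE.
have cY : #|Y| = #|Y :\ y|.+1 by rewrite (cardsD1 y) yY.
have yW : y \notin W by rewrite (disjointFr dYW).
(* Forbidding [y] keeps the edges that cover the rest of [Y] off it, so [y] is still free for an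
   edge of its own. *)
have [|||y' W' yY'|M [sM tM cM coM [dM PM]]] := IH (Y :\ y) (y |: W).
- by lia.
- rewrite disjoint_subset; apply/subsetP=> x; rewrite !inE => /andP[xy xY].
  by rewrite (negPf xy) (disjointFr dYW xY).
- by rewrite cardsU1 yW; nia.
- by apply: hg; move: yY'; rewrite inE => /andP[].
have dM' : [disjoint cover M & W] by apply: disjointWr dM; apply: subsetUr.
have yM : y \notin cover M.
  by apply/negP=> yc; move: (disjointFr dM yc); rewrite !inE eqxx.
have ccM := matching_card sM tM.
have [||e [eH Pe ye de]] := hg y (W :|: cover M) yY.
- have := leq_card_setU W (cover M); case=> h _; apply: leq_trans h _.
  by apply: leq_trans le; rewrite leq_add2l ccM cY mulnC leq_mul // leqW.
- by rewrite inE negb_or yW.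
have d1 : [disjoint e & cover M] by apply: disjointWr de; apply: subsetUr.
have d2 : [disjoint e & W] by apply: disjointWr de; apply: subsetUl.
exists (e |: M); split.
- by rewrite subUset sub1set eH.
- exact: trivIset_setU1.
- by rewrite cardsU1 cY -add1n leq_add ?leq_b1.
- apply/subsetP=> x xY; rewrite cover_setU1 inE.
  have [->|xy] := eqVneq x y; first by rewrite ye.
  by rewrite (subsetP coM) ?orbT // !inE xy.
split; last by move=> e'; rewrite !inE => /orP[/eqP->|/PM].
by rewrite cover_setU1; set_solve.
Qed.

Lemma greedy_matching b (P : pred {set V}) j W :
  #|W| + k * j <= b ->
  (forall W', #|W'| <= b -> exists e, [/\ e \in H, P e & [disjoint e & W']]) ->
  exists M, [/\ M \subset H, trivIset M, #|M| = j, [disjoint cover M & W] &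
    forall e, e \in M -> P e].
Proof.
elim: j => [|j IH] le hg.
  exists set0; rewrite sub0set trivIset_set0 cover_set0 cards0.
  split=> //; last by move=> e; rewrite inE.
  by rewrite disjoint_subset; apply/subsetP=> x; rewrite inE.
have [|//|M [sM tM cM dM PM]] := IH; first by nia.
have ccM := matching_card sM tM.
have [|e [eH Pe de]] := hg (W :|: cover M).
- have := leq_card_setU W (cover M); case=> h _; nia.
have d1 : [disjoint e & cover M] by apply: disjointWr de; apply: subsetUr.
have d2 : [disjoint e & W] by apply: disjointWr de; apply: subsetUl.
exists (e |: M); split.
- by rewrite subUset sub1set eH.
- exact: trivIset_setU1.
- by rewrite cardsU1 notin_disjoint_cover ?(kH eH) ?cM.
- by rewrite cover_setU1; set_solve.
- by move=> e'; rewrite !inE => /orP[/eqP->|/PM].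
Qed.

End Greedy.

(** * Perfect matchings of induced subgraphs and their unions *)

Section Perfect_matchings.
Variables (V : finType) (H : {set {set V}}).

Lemma induced_pmP (U : {set V}) : induced_has_perfect_matching H U <->
  exists M : {set {set V}}, [/\ M \subset H, trivIset M & cover M = U].
Proof.
split=> [[M [[sM tM] cM]]|[M [sM tM cM]]]; exists M; split=> //.
  by apply: subset_trans sM _; apply/subsetP=> e; rewrite inE => /andP[].
split=> //; apply/subsetP=> e eM; rewrite inE (subsetP sM) //= -cM.
exact: sub_cover.
Qed.

Lemma induced_pm0 : induced_has_perfect_matching H set0.
Proof. by apply/induced_pmP; exists set0; rewrite sub0set trivIset_set0 cover_set0. Qed.

Lemma induced_pm1 (e : {set V}) : e \in H -> induced_has_perfect_matching H e.
Proof.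
by move=> eH; apply/induced_pmP; exists [set e]; rewrite sub1set trivIset_set1 cover1.
Qed.

Lemma induced_pmU (A B : {set V}) : [disjoint A & B] ->
  induced_has_perfect_matching H A -> induced_has_perfect_matching H B ->
  induced_has_perfect_matching H (A :|: B).
Proof.
move=> d /induced_pmP[M [sM tM cM]] /induced_pmP[N [sN tN cN]].
apply/induced_pmP; exists (M :|: N); split; last by rewrite cover_setU cM cN.
  by rewrite subUset sM.
by apply: trivIsetU; rewrite // cM cN.
Qed.

Lemma matching_pm (M : {set {set V}}) : M \subset H -> trivIset M ->
  induced_has_perfect_matching H (cover M).
Proof. by move=> sM tM; apply/induced_pmP; exists M. Qed.

Lemma has_pmE : induced_has_perfect_matching H [set: V] -> has_perfect_matching H.
Proof. by move=> /induced_pmP[M [sM tM cM]]; exists M. Qed.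

Lemma card_induced_pm k (U : {set V}) : kgraph k H ->
  induced_has_perfect_matching H U -> k %| #|U|.
Proof.
move=> kH /induced_pmP[M [sM tM <-]]; rewrite (@card_cover_uniform _ _ k) ?dvdn_mull //.
by move=> e /(subsetP sM)/kH.
Qed.

End Perfect_matchings.

(** * Neighbourhoods of [(k-1)]-sets *)

Section Neighbours.
Variables (V : finType) (H : {set {set V}}) (k : nat).
Hypothesis kH : kgraph k H.
Hypothesis k0 : 0 < k.
Implicit Type S : {set V}.

Definition nbr S : {set V} := [set v | (v \notin S) && (v |: S \in H)].

Lemma card_nbr S : #|S| = k.-1 -> #|nbr S| = degree H S.
Proof.
move=> cS; rewrite /degree -(card_in_imset (f := fun v => v |: S) (D := nbr S)).
  apply: eq_card => e; apply/imsetP/idP => [[v]|].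
    by rewrite !inE => /andP[vS vH] ->; rewrite vH subsetUr.
  rewrite inE => /andP[eH sS].
  have : #|e :\: S| == 1 by rewrite cardsD (setIidPr sS) (kH eH) cS; lia.
  case/cards1P=> v ev; have eq : e = v |: S.
    apply/setP=> x; move/setP: ev => /(_ x); rewrite !inE.
    have := subsetP sS x; case: (x \in S) => /= [h _|_ ->]; last by rewrite orbF.
    by rewrite h // orbT.
  exists v => //; rewrite inE -eq eH andbT.
  have : v \in e :\: S by rewrite ev inE eqxx.
  by rewrite inE => /andP[].
move=> u v; rewrite !inE => /andP[uS _] /andP[vS _] /setP/(_ u).
by rewrite !inE eqxx (negPf uS) /= orbF => /esym/eqP.
Qed.

Lemma min_codegree_le S : #|S| = k.-1 -> min_codegree k H <= degree H S.
Proof.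
move=> /eqP cS; rewrite /min_codegree; have := mem_index_enum S.
elim: (index_enum _) => //= T r IH; rewrite inE big_cons => /orP[/eqP <-|/IH le].
  by rewrite cS geq_minl.
by case: ifP => // _; apply: leq_trans le; apply: geq_minr.
Qed.

Lemma nbr_edge S v : v \in nbr S -> v |: S \in H.
Proof. by rewrite inE => /andP[]. Qed.

Lemma nbr_notin S v : v \in nbr S -> v \notin S.
Proof. by rewrite inE => /andP[]. Qed.

End Neighbours.

(** Augmenting paths of length at most three suffice. If [x0] sees no free vertex of [B], at most
    [s] vertices of [B] are free, hence at most [s] of [A] are unmatched, and a free [y0] has more
    than [s] matched neighbours. As [x0] misses at most [s] vertices, it sees the partner of one of
    them, [x1]; then [x0] takes that partner and [x1] takes [y0]. *)
Lemma bipartite_matching (I J : finType) (j0 : J) (A : {set I}) (B : {set J})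
    (r : I -> J -> bool) (s : nat) :
  #|A| = #|B| ->
  (forall i, i \in A -> #|[set j in B | ~~ r i j]| <= s) ->
  (forall j, j \in B -> 2 * s < #|[set i in A | r i j]|) ->
  exists f : I -> J, {in A &, injective f} /\
    forall i, i \in A -> f i \in B /\ r i (f i).
Proof.
move=> cAB hA hB.
suff h (X : {set I}) : X \subset A -> exists f : I -> J, {in X &, injective f} /\
    forall i, i \in X -> f i \in B /\ r i (f i) by apply: h.
have [n] := ubnP #|X|; elim: n X => // n IH X leX sX.
have [->|[x0 x0X]] := set_0Vmem X.
  by exists (fun=> j0); split=> i; rewrite inE.
have cX : #|X| = #|X :\ x0|.+1 by rewrite (cardsD1 x0) x0X.
have x0A := subsetP sX _ x0X.
have sX' : X :\ x0 \subset A by apply: subset_trans (subsetDl _ _) sX.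
have [|//|f [fI fP]] := IH (X :\ x0); first by lia.
pose C := [set f x | x in X :\ x0].
have cC : #|C| = #|X :\ x0| by rewrite card_in_imset.
have sC : C \subset B by apply/subsetP=> j /imsetP[i /fP[? _] ->].
have lXA := subset_leq_card sX.
have ext y : y \in B :\: C -> r x0 y -> exists f : I -> J, {in X &, injective f} /\
    forall i, i \in X -> f i \in B /\ r i (f i).
  rewrite inE => /andP[yC yB] ry.
  have fy i : i \in X -> i != x0 -> f i != y.
    by move=> iX ix; apply: contraNneq yC => <-; apply: imset_f; rewrite !inE ix.
  exists (fun i => if i == x0 then y else f i); split=> [i1 i2 h1 h2|i iX].
    case: eqVneq => [->|n1]; case: eqVneq => [->|n2] // e.
    - by move: (fy _ h2 n2); rewrite e eqxx.
    - by move: (fy _ h1 n1); rewrite e eqxx.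
    - by apply: fI; rewrite // !inE ?n1 ?n2.
  by case: eqVneq => [->|ne] //; apply: fP; rewrite !inE ne.
have [y0] : exists y0, y0 \in B :\: C.
  by apply/card_gt0P; rewrite cardsD (setIidPr sC); lia.
have [/existsP[y /andP[yBC ry]] _|hno] := boolP [exists y, (y \in B :\: C) && r x0 y].
  exact: ext yBC ry.
rewrite inE => /andP[y0C y0B].
have cBC : #|B :\: C| <= s.
  apply: leq_trans (hA _ x0A); apply: subset_leq_card; apply/subsetP=> y yBC.
  rewrite inE; apply/andP; split; first by move: yBC; rewrite inE => /andP[].
  by apply: contra hno => ry; apply/existsP; exists y; rewrite yBC.
have cAX : #|A :\: (X :\ x0)| <= s.
  by move: cBC; rewrite !cardsD (setIidPr sC) (setIidPr sX') cC cAB.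
pose D := [set i in X :\ x0 | r i y0].
have cD : s < #|D|.
  have := hB _ y0B.
  have : [set i in A | r i y0] \subset D :|: (A :\: (X :\ x0)).
    apply/subsetP=> i; rewrite in_set => /andP[iA ri].
    by rewrite in_setU in_setD iA andbT in_set ri andbT orbN.
  by move/subset_leq_card; have := leq_card_setU D (A :\: (X :\ x0)); case; lia.
have [x1 x1D rx1] : exists2 x1, x1 \in D & r x0 (f x1).
  have [/existsP[x1 /andP[? ?]]|hn] := boolP [exists x1, (x1 \in D) && r x0 (f x1)].
    by exists x1.
  have : [set f i | i in D] \subset [set j in B | ~~ r x0 j].
    apply/subsetP=> j /imsetP[i iD ->]; rewrite inE; apply/andP; split.
      by case: (fP i) => //; move: iD; rewrite inE => /andP[].
    by apply: contra hn => h; apply/existsP; exists i; rewrite iD.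
  move/subset_leq_card; rewrite card_in_imset; first by have := hA _ x0A; lia.
  by move=> i1 i2; rewrite !inE => /andP[/andP[? ?] _] /andP[/andP[? ?] _]; apply: fI; rewrite !inE; apply/andP.
move: x1D; rewrite inE => /andP[x1X r1].
have [n1 x1X'] : x1 != x0 /\ x1 \in X by move: x1X; rewrite !inE => /andP[].
have fy i : i \in X -> i != x0 -> f i != y0.
  by move=> iX ix; apply: contraNneq y0C => <-; apply: imset_f; rewrite !inE ix.
have f1 i : i \in X -> i != x0 -> i != x1 -> f i != f x1.
  move=> iX ix i1; apply: contraNneq i1 => e; apply/eqP; apply: fI => //.
  by rewrite !inE ix.
exists (fun i => if i == x0 then f x1 else if i == x1 then y0 else f i).
split=> [i1 i2 h1 h2|i iX].
  have := fy x1 x1X' n1.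
  case: (eqVneq i1 x0) => [a1|a1]; case: (eqVneq i2 x0) => [a2|a2];
  case: (eqVneq i1 x1) => [b1|b1]; case: (eqVneq i2 x1) => [b2|b2] ne e;
    try (by rewrite ?a1 ?a2); try (by rewrite ?b1 ?b2);
    try (by move: ne; rewrite e eqxx);
    try (by move: (f1 _ h1 a1 b1); rewrite e eqxx);
    try (by move: (f1 _ h2 a2 b2); rewrite e eqxx);
    try (by move: (fy _ h1 a1); rewrite e eqxx);
    try (by move: (fy _ h2 a2); rewrite e eqxx).
  by apply: fI; rewrite // !inE ?a1 ?a2.
case: (eqVneq i x0) => [->|a1]; first by split=> //; case: (fP x1).
case: (eqVneq i x1) => [->|b1] //.
by apply: fP; rewrite !inE a1.
Qed.

(** * Nearly complete bipartite patterns *)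

(** The conclusion of a double count: each of [q] bad vertices is missed by at least [p - th], that
    is half, of [p] sets, while each set misses at most [s] vertices. *)
Lemma half_count q p th s : 0 < p -> 2 * th <= p -> q * (p - th) <= p * s -> q <= 2 * s.
Proof.
move=> p0 lep le; rewrite leqNgt; apply/negP=> lt.
have : (2 * s).+1 * (p - th) <= p * s by apply: leq_trans le; rewrite leq_mul2r lt orbT.
have : (2 * s).+1 * p <= (2 * s).+1 * (2 * (p - th)) by rewrite leq_mul2l; lia.
by nia.
Qed.

Section Balanced.
Variables (V : finType) (H : {set {set V}}) (k : nat).
Hypothesis kH : kgraph k H.
Hypothesis k3 : 2 < k.
Implicit Types (A B X Y Z W S T e : {set V}) (F M E : {set {set V}}).

Lemma card_coverI M A : trivIset M -> #|cover M :&: A| = \sum_(e in M) #|e :&: A|.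
Proof.
move=> tM; transitivity (\sum_(x in cover M | x \in A) 1).
  by rewrite -sum1_card; apply: eq_bigl => x; rewrite inE.
rewrite big_trivIset_cond //; apply: eq_bigr => e _ /=.
by rewrite -sum1_card; apply: eq_bigl => x; rewrite inE.
Qed.

Lemma induced_pm_injection F (f : {set V} -> V) :
  trivIset F -> {in F &, injective f} ->
  (forall T, T \in F -> f T \notin cover F /\ f T |: T \in H) ->
  induced_has_perfect_matching H ([set f T | T in F] :|: cover F).
Proof.
have [n] := ubnP #|F|; elim: n F => // n IH F leF tF fI fP.
have [->|[T TF]] := set_0Vmem F.
  by rewrite imset0 cover_set0 setU0; apply: induced_pm0.
have cF : #|F| = #|F :\ T|.+1 by rewrite (cardsD1 T) TF.
have sF : F :\ T \subset F by apply: subsetDl.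
have eF : F = T |: F :\ T by rewrite setD1K.
have dT : [disjoint T & cover (F :\ T)].
  rewrite disjoint_sym; apply: disjoint_cover => T'; rewrite !inE => /andP[ne T'F].
  by rewrite (trivIsetP tF).
have := @IH (F :\ T); case.
- by rewrite cF in leF.
- exact: trivIsetS tF.
- by move=> T1 T2 /(subsetP sF) h1 /(subsetP sF) h2; apply: fI.
- move=> T' /(subsetP sF)/fP[h1 h2]; split=> //; apply: contra h1.
  exact/subsetP/cover_subset.
move=> M PM; have [fT TH] := fP _ TF.
have -> : [set f T | T in F] :|: cover F =
    (f T |: T) :|: ([set f T | T in F :\ T] :|: cover (F :\ T)).
  rewrite {1 2}eF imsetU1 cover_setU1 -!setUA; congr (_ :|: _).
  by rewrite setUCA.
apply: induced_pmU => //; last 1 first.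
- by exists M.
- rewrite disjoint_subset; apply/subsetP=> x; rewrite 2!inE => xT.
  apply/negP; rewrite inE; case/orP: xT => [/eqP->|xT]; case/orP.
  + case/imsetP=> T'; rewrite !inE => /andP[ne T'F] e.
    by move: ne; rewrite -(fI _ _ TF T'F e) eqxx.
  + by move/(subsetP (cover_subset sF)); rewrite (negPf fT).
  + case/imsetP=> T' /(subsetP sF)/fP[h _] e; move: h; rewrite -e.
    by rewrite (subsetP (sub_cover TF)).
  + by rewrite (disjointFr dT xT).
- exact: induced_pm1.
Qed.

(** Cut [B] into [p] disjoint [(k-1)]-sets. By double counting at most [2 * s] vertices of [A] are
    joined to few of these sets; they are covered first, using [rich], by edges with one vertex in
    [A], which preserves the ratio of the two sides. What is left is a bipartite matching between
    vertices of [A] and [(k-1)]-subsets of [B]. *)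
Lemma balanced_pm A B p s b :
  [disjoint A & B] -> #|A| = p -> #|B| = k.-1 * p ->
  (forall T, T \subset B -> #|T| = k.-1 -> #|A :\: nbr H T| <= s) ->
  (forall a W, a \in A -> #|W| <= b ->
     exists T, [/\ T \subset B, [disjoint T & W], #|T| = k.-1 & a \in nbr H T]) ->
  k * (2 * s) <= b -> 2 * (2 * s + 2 * s * k + 1) <= p ->
  induced_has_perfect_matching H (A :|: B).
Proof.
move=> dAB cA cB codeg rich leb lep.
have k10 : 0 < k.-1 by lia.
have [|F [tF cF sF hF]] := @disjoint_family V B k.-1 p k10; first by rewrite cB mulnC.
(* The edges chosen for [Y] destroy at most [2 * s * k] sets of [F], and [bipartite_matching] needs
   more than [2 * s] of them to survive. *)
set th := 2 * s + 2 * s * k + 1.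
pose Y := [set a in A | #|[set T in F | a \in nbr H T]| < th].
have sY : Y \subset A by apply/subsetP=> a; rewrite inE => /andP[].
have cY : #|Y| <= 2 * s.
  have := double_count F Y (fun T a => a \notin nbr H T) => dc.
  have u : \sum_(T in F) #|[set a in Y | a \notin nbr H T]| <= p * s.
    rewrite -cF -sum_nat_const; apply: leq_sum => T TF.
    apply: leq_trans (codeg T _ (hF _ TF)); last first.
      by apply: subset_trans sF; apply: sub_cover.
    apply: subset_leq_card; apply/subsetP=> a; rewrite !inE => /andP[/andP[-> _] ->] //.
  have l : #|Y| * (p - th) <= \sum_(a in Y) #|[set T in F | a \notin nbr H T]|.
    rewrite -sum_nat_const; apply: leq_sum => a; rewrite inE => /andP[_ lt].
    have := cardsID [set T | a \in nbr H T] F; rewrite cF.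
    have -> : F :&: [set T | a \in nbr H T] = [set T in F | a \in nbr H T].
      by apply/setP=> T; rewrite !inE.
    have -> : F :\: [set T | a \in nbr H T] = [set T in F | a \notin nbr H T].
      by apply/setP=> T; rewrite !inE andbC.
    by move=> e; rewrite leq_subLR -[X in X <= _]e leq_add2r ltnW.
  apply: (half_count (p := p) (th := th)) => //.
    by apply: leq_trans lep; rewrite addnC.
  by apply: leq_trans u; rewrite dc.
pose P e := (#|e :&: A| == 1) && (e \subset A :|: B).
have [||y W' yY leW yW'|MY [sM tM cM coM [_ PM]]] :=
    @greedy_cover V H k kH (ltnW (ltnW k3)) b P Y set0.
- by rewrite disjoint_subset; apply/subsetP=> x; rewrite !inE.
- by rewrite cards0 add0n; apply: leq_trans leb; rewrite leq_mul2l cY orbT.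
- have yA := subsetP sY _ yY.
  have [T [sT dT cT yT]] := rich y W' yA leW.
  have yT' := nbr_notin yT.
  exists (y |: T); split; first exact: nbr_edge.
  + apply/andP; split.
      apply/cards1P; exists y; apply/setP=> x; rewrite !inE.
      case: eqVneq => [->|_] /=; first by rewrite yA.
      by apply/negP=> /andP[/(subsetP sT) xB xA]; rewrite (disjointFr dAB xA) in xB.
    by rewrite subUset sub1set inE yA (subset_trans sT) ?subsetUr.
  + exact: setU11.
  + rewrite disjoint_subset; apply/subsetP=> x; rewrite !inE => /orP[/eqP->//|xT].
    by rewrite (disjointFr dT xT).
have ccM := matching_card kH sM tM.
have cMA : #|cover MY :&: A| = #|MY|.
  rewrite card_coverI // -sum1_card; apply: eq_bigr => e /PM/andP[/eqP-> _] //.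
have sMAB : cover MY \subset A :|: B by apply: cover_sub => e /PM/andP[].
have cMB : #|cover MY :&: B| = k.-1 * #|MY|.
  have := cardsID A (cover MY); rewrite ccM cMA.
  have -> : cover MY :\: A = cover MY :&: B by set_solve.
  by rewrite -{1}(prednK (ltnW (ltnW k3))) mulnS => /addnI->; rewrite mulnC.
pose A1 := A :\: cover MY; pose B1 := B :\: cover MY.
pose T1 := [set T in F | [disjoint T & cover MY]].
have sT1F : T1 \subset F by apply/subsetP=> T; rewrite inE => /andP[].
have tT1 : trivIset T1 by apply: trivIsetS tF.
have hT1 T : T \in T1 -> #|T| = k.-1 by move/(subsetP sT1F)/hF.
have cT1 := card_cover_uniform tT1 hT1.
have sT1 : cover T1 \subset B1.
  rewrite subsetD (subset_trans (cover_subset sT1F)) //=.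
  by apply: disjoint_cover => T; rewrite inE => /andP[].
have cA1 : #|A1| = p - #|MY|.
  by rewrite cardsD cA setIC cMA.
have leMp : #|MY| <= p by rewrite -cMA -cA subset_leq_card ?subsetIr.
have cB1 : #|B1| = (p - #|MY|) * k.-1.
  by rewrite cardsD cB setIC cMB -mulnBr mulnC.
have leT1 : #|T1| <= p - #|MY|.
  by move: (subset_leq_card sT1); rewrite cB1 cT1 leq_mul2r; move: k10; case: k.-1.
(* The untouched sets of [F] are kept, since the degrees are known for them; the rest of [B1] may be
   cut up arbitrarily. *)
have [|T2 [tT2 cT2 sT2 hT2]] :=
    @disjoint_family V (B1 :\: cover T1) k.-1 (p - #|MY| - #|T1|) k10.
  by rewrite cardsD (setIidPr sT1) cB1 cT1 -mulnBl.
have dT12 : [disjoint cover T1 & cover T2] by set_solve.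
pose TT := T1 :|: T2.
have tTT : trivIset TT by apply: trivIsetU.
have hTT T : T \in TT -> #|T| = k.-1 by rewrite inE => /orP[/hT1|/hT2].
have cTT : #|TT| = p - #|MY|.
  rewrite cardsU (_ : T1 :&: T2 = set0) ?cards0 ?cT2; first by move: leT1; clear; lia.
  apply/setP=> T; rewrite [in RHS]inE; apply/negP; rewrite inE => /andP[h1 h2].
  have d : [disjoint T & cover T2] by apply: disjointWl dT12; apply: sub_cover.
  by have := notin_disjoint_cover _ d; rewrite h2 (hT1 _ h1) => /(_ k10).
have sTT : cover TT \subset B1 by rewrite cover_setU; set_solve.
have coTT : cover TT = B1.
  by apply/eqP; rewrite eqEcard sTT (card_cover_uniform tTT hTT) cTT cB1 leqnn.
have [a0 a0A] : exists a0, a0 \in A by apply/card_gt0P; rewrite cA; move: lep; clear; lia.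
have [|||f [fI fP]] :=
    @bipartite_matching _ _ a0 TT A1 (fun T a => a \in nbr H T) s; rewrite ?cTT ?cA1 //.
- move=> T TTT; apply: leq_trans (codeg T _ (hTT _ TTT)); last first.
    apply: subset_trans (sub_cover TTT) (subset_trans sTT _); exact: subsetDl.
  apply: subset_leq_card; apply/subsetP=> a; rewrite inE => /andP[].
  by rewrite inE => /andP[_ aA] aT; rewrite inE aT.
- move=> a; rewrite inE => /andP[aM aA].
  have : ~~ (a \in Y) by apply: contra aM; apply: (subsetP coM).
  rewrite inE aA /= -leqNgt => ge.
  have sub : [set T in F | a \in nbr H T] \subset
      [set T in TT | a \in nbr H T] :|: [set T in F | ~~ [disjoint T & cover MY]].
    apply/subsetP=> T; rewrite in_set => /andP[TF aT].
    apply/setUP; case d: [disjoint T & cover MY]; [left|right].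
      by rewrite in_set aT andbT in_setU in_set TF d.
    by rewrite in_set TF d.
  have le1 := leq_trans (leq_trans ge (subset_leq_card sub)) (leq_card_setU _ _).1.
  have le2 : #|[set T in F | ~~ [disjoint T & cover MY]]| <= 2 * s * k.
    apply: leq_trans (card_meeting _ tF) _.
    by rewrite ccM leq_mul2r (leq_trans cM cY) orbT.
  move: (leq_trans le1 (leq_add (leqnn _) le2)).
  by rewrite /th addnAC leq_add2r addn1.
have pm2 := @induced_pm_injection TT f tTT fI _.
have eA1 : [set f T | T in TT] = A1.
  apply/eqP; rewrite eqEcard card_in_imset // cTT cA1 leqnn andbT.
  by apply/subsetP=> a /imsetP[T /fP[? _] ->].
rewrite (_ : A :|: B = cover MY :|: (A1 :|: cover TT)); last first.
  by rewrite coTT; move: sMAB; rewrite /A1 /B1; clear; move=> ?; set_solve.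
apply: induced_pmU.
- by rewrite coTT /A1 /B1; clear; set_solve.
- exact: matching_pm.
- rewrite -eA1; apply: pm2 => T TTT; have [fA fN] := fP _ TTT.
  split; last exact: nbr_edge.
  rewrite coTT inE; move: fA; rewrite inE => /andP[_ fA].
  by rewrite (disjointFr dAB fA) andbF.
Qed.

End Balanced.

(** * Near-perfect matchings *)

Section Near_perfect.
Variables (V : finType) (H : {set {set V}}) (k m : nat).
Hypothesis kH : kgraph k H.
Hypothesis k3 : 2 < k.
Hypothesis cV : #|V| = k * m.
Hypothesis hdeg : forall S : {set V}, #|S| = k.-1 -> m <= #|nbr H S|.
Implicit Types (A B X Y Z W S T e : {set V}) (F M E N : {set {set V}}).

(** Replacing [M0] by [N] inside [M] gives a matching again, so by maximality nothing is gained. *)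
Lemma maximum_matching_exchange E M M0 N :
  (forall e, e \in E -> 0 < #|e|) ->
  M \subset E -> trivIset M ->
  (forall M', M' \subset E -> trivIset M' -> #|M'| <= #|M|) ->
  M0 \subset M -> N \subset E -> trivIset N ->
  [disjoint cover N & cover (M :\: M0)] -> #|N| <= #|M0|.
Proof.
move=> E0 sM tM mM sM0 sN tN d.
have := mM (N :|: (M :\: M0)); rewrite subUset sN (subset_trans (subsetDl _ _)) //.
rewrite trivIsetU // => [/(_ isT isT)|]; last exact: trivIsetS (subsetDl _ _) tM.
have dN : [disjoint N & M :\: M0].
  apply/disjointP=> e eN; apply/negP=> eM.
  have := notin_disjoint_cover (E0 _ (subsetP sN _ eN)) (disjointWl (sub_cover eN) d).
  by rewrite eM.
have -> : #|N :|: (M :\: M0)| = #|N| + #|M :\: M0|.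
  by apply/eqP; rewrite (leq_card_setU N (M :\: M0)).2.
rewrite cardsD (setIidPr sM0) => le.
have := subset_leq_card sM0; move: le.
by move: #|N| #|M| #|M0| => a b c; clear; lia.
Qed.

(** Let [M] be maximum outside [W] and suppose that the uncovered set holds [2 * k^2] disjoint
    [(k-1)]-sets. All their neighbours lie in [W] or in edges of [M]. Exchanging one edge for two is
    impossible, so an edge of [M] carries more than half of the possible incidences only through a
    single vertex, its centre. Counting yields at least [m - 2 * #|W|] edges with centres; an edge
    [f] that avoids the centres allows a final exchange. *)
Lemma near_perfect_matching W :
  (forall B, #|~: B| <= m + 2 * k * #|W| -> exists2 e, e \in H & e \subset B) ->
  exists M, [/\ M \subset H, trivIset M, [disjoint cover M & W] &
    #|~: (W :|: cover M)| < 2 * (k * k) * k.-1].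
Proof.
move=> nonext.
have k0 : 0 < k by apply: ltnW (ltnW k3).
have k10 : 0 < k.-1 by move: k3; case: k => [|[]].
pose E := [set e in H | [disjoint e & W]].
have sEH : E \subset H by apply/subsetP=> e; rewrite inE => /andP[].
have E0 e : e \in E -> 0 < #|e| by move/(subsetP sEH)/kH->.
have [M [sM tM mM meet]] := ex_maximum_matching E0.
have exch := maximum_matching_exchange E0 sM tM mM.
have dMW : [disjoint cover M & W].
  by apply: disjoint_cover => e /(subsetP sM); rewrite inE => /andP[].
exists M; split=> //; first exact: subset_trans sEH.
set U := ~: _; rewrite ltnNge; apply/negP=> geU.
set th := k * k in geU.
have [F [tF cF sF hF]] := disjoint_family k10 geU.
have dUM : [disjoint U & cover M] by rewrite /U; clear; set_solve.
have dUW : [disjoint U & W] by rewrite /U; clear; set_solve.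
have sTU T : T \in F -> T \subset U by move=> TF; apply: subset_trans sF; apply: sub_cover.
have edgeE v T : T \in F -> v \in nbr H T -> v \notin W -> v |: T \in E.
  move=> TF vT vW; rewrite inE nbr_edge //=; apply/disjointP=> x.
  by rewrite in_setU1 => /orP[/eqP->//|/(subsetP (sTU _ TF))]; apply: (disjointP _ _ dUW).
have nbrs T : T \in F -> nbr H T \subset W :|: cover M.
  move=> TF; apply/subsetP=> v vT; rewrite in_setU.
  case vW: (v \in W) => //=; apply/negPn/negP=> vM.
  have /meet/negP[] : v |: T \in E by apply: edgeE; rewrite ?vW.
  apply/disjointP=> x; rewrite in_setU1 => /orP[/eqP->//|/(subsetP (sTU _ TF))].
  exact: (disjointP _ _ dUM).
have nbrM T : T \in F -> m <= #|cover M :&: nbr H T| + #|W|.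
  move=> TF; apply: leq_trans (hdeg (hF _ TF)) _.
  apply: leq_trans (leq_card_setU _ _).1; apply: subset_leq_card.
  by have := nbrs _ TF; move: (nbr H T) => X; clear; move=> ?; set_solve.
have eW e v : e \in M -> v \in e -> v \notin W.
  by move=> eM ve; apply: (disjointP _ _ dMW); apply: (subsetP (sub_cover eM)).
(* Otherwise [e] could be exchanged for the two disjoint edges [v |: T] and [v' |: T']. *)
have star e T T' v v' : e \in M -> T \in F -> T' \in F -> v \in e -> v' \in e ->
    v \in nbr H T -> v' \in nbr H T' -> v != v' -> T = T'.
  move=> eM TF T'F ve v'e vT vT' nv; apply/eqP/negPn/negP=> nT.
  have dT := trivIsetP tF _ _ TF T'F nT.
  have eUM x X : X \in F -> x \in X -> x \in cover M = false.
    by move=> XF xX; apply: (disjointFr dUM); apply: (subsetP (sTU _ XF)).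
  have vM : v \in cover M by apply: (subsetP (sub_cover eM)).
  have v'M : v' \in cover M by apply: (subsetP (sub_cover eM)).
  have d12 : [disjoint v |: T & v' |: T'].
    apply/disjointP=> x; rewrite in_setU1 => /orP[/eqP->|xT]; rewrite in_setU1 negb_or.
      rewrite nv; apply/negP=> vT''; by rewrite (eUM _ _ T'F vT'') in vM.
    rewrite (disjointFr dT xT) andbT; apply: contraTneq v'M => <-.
    by rewrite (eUM _ _ TF xT).
  have N2 : #|[set v |: T; v' |: T']| = 2.
    rewrite cards2; case: eqVneq => // eq; move: d12; rewrite eq -setI_eq0 setIid.
    by move/eqP/setP/(_ v'); rewrite !inE eqxx.
  have := exch [set e] [set v |: T; v' |: T']; rewrite N2 cards1 sub1set eM.
  rewrite subUset !sub1set !edgeE ?(eW e) //= => h; suff : false by [].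
  apply: h => //.
    by apply: trivIset_setU1; rewrite ?trivIset_set1 ?cover1.
  rewrite cover_setU1 cover1 cover_setD ?sub1set // cover1.
  apply/disjointP=> x; rewrite in_setD negb_and negbK !inE -!orbA.
  case/or4P=> [/eqP->|xT|/eqP->|xT]; rewrite ?ve ?v'e //.
    by rewrite (eUM _ _ TF xT) orbT.
  by rewrite (eUM _ _ T'F xT) orbT.
pose deg v := #|[set T in F | v \in nbr H T]|.
pose D e := \sum_(T in F) #|e :&: nbr H T|.
have De e : D e = \sum_(v in e) deg v.
  rewrite /deg -(double_count F e (fun T v => v \in nbr H T)); apply: eq_bigr => T _.
  by congr #|pred_of_set _|; apply/setP=> v; rewrite in_set in_setI.
have kth : k <= th by rewrite leq_pmull.
have th2 : 2 <= th by apply: leq_trans kth; apply: ltnW.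
pose good e := [exists v in e, th < deg v].
have degF v : deg v <= 2 * th.
  by rewrite -cF; apply: subset_leq_card; apply/subsetP=> T; rewrite in_set => /andP[].
(* If [v] has degree above [th >= 2], then by [star] no other vertex of [e] has positive degree, and
   [deg v] is at most [2 * th]. *)
have Dgood e : e \in M -> D e <= th + th * good e.
  move=> eM; have [/existsP[v /andP[ve dv]]|nb] := boolP (good e).
    rewrite De (bigD1 v) //= big1 ?addn0 ?muln1 ?addnn -?mul2n // => v' /andP[v'e nv].
    apply/eqP; rewrite cards_eq0; apply/negPn/negP=> /set0Pn[T'].
    rewrite in_set => /andP[T'F v'T'].
    have : [set T in F | v \in nbr H T] \subset [set T'].
      apply/subsetP=> T; rewrite in_set => /andP[TF vT]; rewrite inE; apply/eqP.
      by apply: (star e T T' v v'); rewrite // eq_sym.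
    move/subset_leq_card; rewrite cards1 => le; have := leq_trans dv le.
    by rewrite ltnNge (ltnW th2).
  rewrite muln0 addn0.
  have le v : v \in e -> deg v <= th.
    move=> ve; rewrite leqNgt; apply: contra nb => lt.
    by apply/existsP; exists v; rewrite ve.
  have [/existsP[v /andP[ve dv]]|hn] := boolP [exists v in e, 0 < deg v]; last first.
    rewrite De big1 // => v ve; apply/eqP; rewrite -leqn0 leqNgt.
    by apply: contra hn => lt; apply/existsP; exists v; rewrite ve.
  have [/existsP[v' /and3P[v'e nv dv']]|hn] :=
      boolP [exists v', [&& v' \in e, v' != v & 0 < deg v']]; last first.
    rewrite De (bigD1 v) //= big1 ?addn0 ?le // => v' /andP[v'e nv]; apply/eqP.
    rewrite -leqn0 leqNgt; apply: contra hn => lt; apply/existsP; exists v'.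
    by rewrite v'e nv.
  case/card_gt0P: dv => T; rewrite in_set => /andP[TF vT].
  (* Two vertices of positive degree force, by [star], all incidences at [e] to come from one set
     [T], so there are at most [k <= th] of them. *)
  have uniqT u T' : u \in e -> T' \in F -> u \in nbr H T' -> T' = T.
    move=> ue T'F uT'; case: (eqVneq u v) => [euv|nuv]; last first.
      by apply: (star e T' T u v).
    case/card_gt0P: dv' => T''; rewrite in_set => /andP[T''F vT''].
    have e1 : T'' = T by apply: (star e T'' T v' v).
    by rewrite -e1; apply: (star e T' T'' u v') => //; rewrite euv eq_sym.
  rewrite De; apply: leq_trans kth; rewrite -(kH (subsetP sEH _ (subsetP sM _ eM))).
  rewrite -sum1_card; apply: leq_sum => u ue; rewrite -(cards1 T).
  apply: subset_leq_card; apply/subsetP=> T'; rewrite in_set => /andP[T'F uT'].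
  by rewrite inE (uniqT u T').
pose G := [set e in M | good e].
have sG : G \subset M by apply/subsetP=> e; rewrite inE => /andP[].
have tG : trivIset G by apply: trivIsetS tM.
have cM : #|M| <= m.
  have := max_card [in cover M]; rewrite (matching_card kH _ tM) ?(subset_trans sM) //.
  by rewrite cV mulnC leq_pmul2l.
(* Summing over [F] gives [2 * th * m <= th * (#|M| + #|G|) + 2 * th * #|W|], and [#|M| <= m]. *)
have cG : m <= #|G| + 2 * #|W|.
  have u : \sum_(T in F) #|cover M :&: nbr H T| <= th * (#|M| + #|G|).
    rewrite (eq_bigr (fun T => \sum_(e in M) #|e :&: nbr H T|)); last first.
      by move=> T _; apply: card_coverI.
    rewrite exchange_big /=.
    have l1 : \sum_(e in M) D e <= \sum_(e in M) (th + th * good e) by exact: leq_sum.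
    apply: leq_trans l1 _.
    rewrite big_split /= sum_nat_const -big_distrr /= mulnDr mulnC leq_add2l leq_mul2l.
    rewrite -sum1_card [X in _ <= X](eq_bigl (fun e => (e \in M) && good e)); last first.
      by move=> e; rewrite inE.
    by rewrite big_mkcondr /=; apply/orP; right; apply: leq_sum => e _; case: (good e).
  have l : 2 * th * m <= \sum_(T in F) #|cover M :&: nbr H T| + 2 * th * #|W|.
    rewrite -cF -!sum_nat_const -big_split /=; exact: leq_sum.
  have := leq_trans l (leq_add u (leqnn _)).
  rewrite [2 * th]mulnC -!mulnA -!mulnDr !(leq_pmul2l k0).
  move: cM; move: #|M| #|G| #|W| => a b c; clear; lia.
have [v0 _] : exists v0, v0 \in U.
  by apply/card_gt0P; apply: leq_trans geU; rewrite !muln_gt0 k0.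
pose c e := odflt v0 [pick v in e | th < deg v].
have cP e : e \in G -> c e \in e /\ th < deg (c e).
  rewrite inE => /andP[_ /existsP[v /andP[ve dv]]]; rewrite /c.
  by case: pickP => [v' /andP[]|/(_ v)] //; rewrite ve dv.
have sGM e : e \in G -> e \in M by apply: (subsetP sG).
have c_in e e' : e \in G -> e' \in M -> c e \in e' -> e' = e.
  move=> eG e'M ce; apply/eqP/negPn/negP=> ne; have [ce' _] := cP _ eG.
  by have := disjointFr (trivIsetP tM _ _ e'M (sGM _ eG) ne) ce; rewrite ce'.
have cI : {in G &, injective c}.
  move=> e e' eG e'G ec; have [ce _] := cP _ eG.
  by apply: c_in (sGM _ eG) _ => //; rewrite -ec.
pose B := cover G :\: [set c e | e in G].
have scG : [set c e | e in G] \subset cover G.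
  by apply/subsetP=> x /imsetP[e eG ->]; apply: (subsetP (sub_cover eG)); case: (cP _ eG).
have GH : G \subset H by apply: subset_trans sG (subset_trans sM sEH).
have [f fH fB] : exists2 f, f \in H & f \subset B.
  apply: nonext; rewrite cardsCs setCK cV cardsD (setIidPr scG) card_in_imset //.
  rewrite (matching_card kH GH tG); move: cG; move: #|G| #|W| => g w cG.
  move: k3 cG; clear; case: k => // k' _ le.
  have : k' * m <= k' * (g + 2 * w) by rewrite leq_mul2l le orbT.
  by clear le; lia.
have fG : f \subset cover G by apply: subset_trans fB (subsetDl _ _).
have fM : f \subset cover M by apply: subset_trans fG (cover_subset sG).
have fE : f \in E by rewrite inE fH; apply: disjointWl dMW.
have fc e : e \in G -> c e \notin f.
  move=> eG; apply/negP=> /(subsetP fB).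
  by rewrite in_setD imset_f.
(* The at most [k] edges met by [f] are exchanged for [f] and, for each of them, an edge through its
   centre and otherwise uncovered vertices. A centre lies in more than [k * k] such edges with
   pairwise disjoint uncovered parts, so these can be chosen greedily. *)
pose Ef := [set e in G | ~~ [disjoint e & f]].
have sEfG : Ef \subset G by apply/subsetP=> e; rewrite inE => /andP[].
have sEfM : Ef \subset M by apply: subset_trans sEfG sG.
have cEf : #|Ef| <= k by rewrite -(kH fH); apply: card_meeting tG.
pose Y := [set c e | e in Ef].
have cY : #|Y| = #|Ef|.
  by rewrite card_in_imset // => e e' /(subsetP sEfG) h /(subsetP sEfG) h'; apply: cI.
have sYM : Y \subset cover M.
  apply/subsetP=> y /imsetP[e /(subsetP sEfG) eG ->].
  by apply: (subsetP (sub_cover (sGM _ eG))); case: (cP _ eG).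
have dYU : [disjoint U & Y] by apply: disjointWr dUM.
pose P e := (#|e :&: Y| == 1) && (e \subset Y :|: U).
have kE : kgraph k E by move=> e /(subsetP sEH)/kH.
have [||y W' yY leW yW'|N [sN tN cN coN [_ PN]]] := @greedy_cover V E k kE k0 th P Y set0.
- by apply/disjointP=> x; rewrite !inE.
- by rewrite cards0 add0n cY leq_mul2l cEf orbT.
- have [e eEf ye] := imsetP yY; have eG := subsetP sEfG _ eEf.
  have [ce dce] := cP _ eG; rewrite -ye in ce dce.
  have [T] : exists T, T \in [set T in F | y \in nbr H T] :\: [set T in F | ~~ [disjoint T & W']].
    apply/card_gt0P; rewrite cardsD subn_gt0; apply: leq_ltn_trans dce.
    apply: leq_trans leW; apply: leq_trans (card_meeting W' tF).
    by apply: subset_leq_card; apply: subsetIr.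
  rewrite in_setD !in_set => /andP[+ /andP[TF yT]]; rewrite TF negbK /= => dT.
  have yT' : y \in nbr H T by rewrite inE.
  have yW := eW _ _ (sGM _ eG) ce.
  exists (y |: T); split; first exact: edgeE.
  + apply/andP; split.
      apply/cards1P; exists y; apply/setP=> x; rewrite in_setI in_setU1 in_set1.
      case: eqVneq => [->|_] /=; first by rewrite yY.
      apply/negP=> /andP[/(subsetP (sTU _ TF)) xU xY].
      by rewrite (disjointFr dYU xU) in xY.
    by rewrite subUset sub1set in_setU yY (subset_trans (sTU _ TF)) ?subsetUr.
  + exact: setU11.
  + apply/disjointP=> x; rewrite in_setU1 => /orP[/eqP->//|xT].
    by rewrite (disjointFr dT xT).
have sNYU : cover N \subset Y :|: U by apply: cover_sub => e /PN/andP[].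
have cNY : #|N| = #|Ef|.
  rewrite -cY -(setIidPr coN) card_coverI // -sum1_card.
  by apply: eq_bigr => e /PN/andP[/eqP].
have dfN : [disjoint f & cover N].
  apply/disjointP=> x xf; apply/negP=> /(subsetP sNYU); rewrite in_setU => /orP[xY|xU].
    by case/imsetP: xY => e /(subsetP sEfG) eG ex; move: (fc _ eG); rewrite -ex xf.
  by have := subsetP fM _ xf; rewrite (disjointFr dUM xU).
have := exch Ef (f |: N) sEfM.
rewrite subUset sub1set fE sN => /(_ isT) h.
have {h} : #|f |: N| <= #|Ef|.
  apply: h; first exact: trivIset_setU1.
  rewrite cover_setU1 cover_setD //; apply/disjointP=> x; rewrite in_setU in_setD.
  case/orP=> [xf|/(subsetP sNYU)].
    suff -> : x \in cover Ef by [].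
    case/bigcupP: (subsetP fG _ xf) => e eG xe; apply/bigcupP; exists e => //.
    by rewrite in_set eG; apply/negP=> /disjointP/(_ _ xe); rewrite xf.
  rewrite in_setU => /orP[/imsetP[e eEf ->]|xU].
    suff -> : c e \in cover Ef by [].
    by apply: (subsetP (sub_cover eEf)); case: (cP _ (subsetP sEfG _ eEf)).
  by rewrite (disjointFr dUM xU) andbF.
by rewrite cardsU1 notin_disjoint_cover ?(kH fH) // cNY ltnn.
Qed.

End Near_perfect.

(** * The extremal case *)

Section Extremal.
Variables (V : finType) (H : {set {set V}}) (k m : nat).
Hypothesis kH : kgraph k H.
Hypothesis k3 : 2 < k.
Hypothesis cV : #|V| = k * m.
Hypothesis hdeg : forall S : {set V}, #|S| = k.-1 -> m <= #|nbr H S|.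
Implicit Types (A B X Y Z W S T e : {set V}) (F M E N : {set {set V}}).

Lemma exists_notin X W : #|W| < #|X| -> exists2 x, x \in X & x \notin W.
Proof.
move=> lt; have : 0 < #|X :\: W|.
  by rewrite cardsD subn_gt0; apply: leq_ltn_trans lt; apply: subset_leq_card (subsetIr _ _).
by case/card_gt0P=> x; rewrite inE => /andP[? ?]; exists x.
Qed.

Lemma exists_avoiding X W j : #|W| + j <= #|X| ->
  exists Y, [/\ Y \subset X, [disjoint Y & W] & #|Y| = j].
Proof.
move=> le; have [|Y] := @exists_subset_card V (X :\: W) j.
  rewrite cardsD; have := subset_leq_card (subsetIr X W).
  by move: le; move: #|W| #|X| #|X :&: W| => a b c; clear; lia.
by rewrite subsetD => /andP[? ?] ?; exists Y.
Qed.

Lemma card_disjointU X Y : [disjoint X & Y] -> #|X :|: Y| = #|X| + #|Y|.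
Proof. by move=> d; apply/eqP; rewrite (leq_card_setU X Y).2. Qed.

Lemma card_setC A : #|~: A| = k * m - #|A|.
Proof. by rewrite cardsCs setCK cV. Qed.

(* When all intersections with [A] are odd, edges of excess [|e :&: A| - 1 = 2]
   realise every even surplus; one even edge, of excess at most [s], corrects
   the parity. *)
Lemma surplus_matching A s : #|A| = m + s -> k * (3 * s + 3) <= m ->
  (odd s -> exists2 e, e \in H & ~~ odd #|e :&: A|) ->
  exists M, [/\ M \subset H, trivIset M, #|M| <= s.+1 & #|cover M :&: A| = #|M| + s].
Proof.
move=> cA lem hpar.
have k0 : 0 < k by apply: ltnW (ltnW k3).
(* Each such edge has excess 1, so [s] disjoint ones settle the claim. *)
pose E2 := [set e in H | #|e :&: A| == 2].
have sE2 : E2 \subset H by apply/subsetP=> e; rewrite inE => /andP[].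
have E20 e : e \in E2 -> 0 < #|e| by move/(subsetP sE2)/kH->.
have [M [sM tM mM meet]] := ex_maximum_matching E20.
have [/exists_subset_card[M' sM' cM']|ltM] := leqP s #|M|.
  have tM' : trivIset M' by apply: trivIsetS tM.
  exists M'; rewrite tM' cM' leqnSn; split=> //.
    exact: subset_trans sM' (subset_trans sM sE2).
  rewrite card_coverI // (eq_bigr (fun=> 2)) ?sum_nat_const ?cM' ?muln2 ?addnn //.
  by move=> e /(subsetP sM')/(subsetP sM); rewrite inE => /andP[_ /eqP].
have cC : #|cover M| <= k * s.
  by rewrite (matching_card kH _ tM) ?(subset_trans sM) // mulnC leq_mul2l ltnW ?orbT.
(* Take two vertices of [A] and [k - 3] outside, away from [W] and [M]. A neighbour off [A] would
   give an edge of [E2] disjoint from the maximum matching [M], so a neighbour away from [W1] lies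
   in [A]. *)
have h3 W : #|W| <= k * s.+1 ->
    exists e, [/\ e \in H, #|e :&: A| == 3 & [disjoint e & W]].
  move=> leW; pose W1 := W :|: cover M.
  have cW1 : #|W1| <= k * s.+1 + k * s.
    by apply: leq_trans (leq_card_setU _ _).1 (leq_add leW cC).
  have [|X [sX dX cX]] := @exists_avoiding A W1 2.
    rewrite cA; move: cW1 lem k3; move: #|W1| => w; clear; nia.
  have [|Y [sY dY cY]] := @exists_avoiding (~: A) W1 (k - 3).
    rewrite card_setC cA; move: cW1 lem k3; move: #|W1| => w; clear.
    case: k => [|[|[|k']]] //; nia.
  have dXY : [disjoint X & Y] by clear -sX sY; set_solve.
  have cS : #|X :|: Y| = k.-1.
    by rewrite card_disjointU // cX cY; move: k3; clear; lia.
  have [|v vS vW] := @exists_notin (nbr H (X :|: Y)) W1.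
    apply: leq_trans (hdeg cS).
    move: cW1 lem k3; move: #|W1| => w; clear; nia.
  have vXY := nbr_notin vS.
  have dW : [disjoint v |: (X :|: Y) & W1].
    apply/disjointP=> x; rewrite !in_setU1 in_setU => /orP[/eqP->//|/orP[xX|xY]].
      by rewrite (disjointFr dX).
    by rewrite (disjointFr dY).
  exists (v |: (X :|: Y)); split; first exact: nbr_edge.
    have vA : v \in A.
      apply/negPn/negP=> vA.
      have /meet : v |: (X :|: Y) \in E2.
        rewrite inE nbr_edge //= -cX; apply/eqP; congr #|pred_of_set _|.
        apply/setP=> x; rewrite in_setI in_setU1 in_setU.
        case: eqVneq => [->|_] /=.
          by rewrite (negPf vA); apply/esym/negP=> /(subsetP sX); rewrite (negPf vA).
        case xA: (x \in A); rewrite ?andbF ?andbT.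
          case xY: (x \in Y); rewrite ?orbF //.
          by have := subsetP sY _ xY; rewrite in_setC xA.
        by apply/esym/negP=> /(subsetP sX); rewrite xA.
      by case/negP; apply: disjointWr dW; apply: subsetUr.
    have -> : (v |: (X :|: Y)) :&: A = v |: X.
      apply/setP=> x; rewrite in_setI !in_setU1 in_setU.
      case: eqVneq => [->|_] /=; first by rewrite vA.
      case xA: (x \in A); rewrite ?andbF ?andbT.
        case xY: (x \in Y); rewrite ?orbF //.
        by have := subsetP sY _ xY; rewrite in_setC xA.
      by apply/esym/negP=> /(subsetP sX); rewrite xA.
    by rewrite cardsU1 cX; move: vXY; rewrite in_setU negb_or => /andP[-> _].
  by apply: disjointWr dW; apply: subsetUl.
have sum3 (N : {set {set V}}) : trivIset N -> (forall e, e \in N -> #|e :&: A| == 3) ->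
    #|cover N :&: A| = #|N| * 3.
  by move=> tN hN; rewrite card_coverI // -sum_nat_const; apply: eq_bigr => e /hN/eqP.
have half2 := odd_double_half s.
case os: (odd s); rewrite os in half2 hpar; last first.
  have [||N [sN tN cN dN hN]] := @greedy_matching V H k kH k0 (k * s.+1)
    (fun e => #|e :&: A| == 3) s./2 set0.
  - rewrite cards0 add0n leq_mul2l; apply/orP; right; move: half2; clear; lia.
  - exact: h3.
  exists N; split=> //; first by rewrite cN; move: half2; clear; lia.
  by rewrite sum3 // cN; move: half2; clear; lia.
(* The excess of [e0] must not exceed [s]. If [k <= s + 1], any even edge will do; otherwise one
   with exactly [s + 1] vertices in [A] is built, an even number as [s] is odd. *)
have [e0 [e0H e0A le0]] : exists e0, [/\ e0 \in H, ~~ odd #|e0 :&: A| & #|e0 :&: A| <= s.+1].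
  have [lt|ge] := leqP k s.+1.
    have [e eH eA] := hpar isT; exists e; split=> //; apply: leq_trans lt.
    by rewrite -(kH eH) subset_leq_card ?subsetIl.
  have [|X sX cX] := @exists_subset_card V A s.+1.
    by rewrite cA; move: lem k3; clear; nia.
  have [|Y sY cY] := @exists_subset_card V (~: A) (k.-1 - s.+1).
    rewrite card_setC cA; move: lem k3; clear; case: k => [|[|[|k']]] //; nia.
  have dXY : [disjoint X & Y] by clear -sX sY; set_solve.
  have cS : #|X :|: Y| = k.-1.
    by rewrite card_disjointU // cX cY; move: ge; clear; lia.
  (* As [A :\: X] has only [m - 1] vertices, some neighbour lies outside [A]. *)
  have [|v vS vA] := @exists_notin (nbr H (X :|: Y)) (A :\: X).
    apply: leq_trans (hdeg cS); rewrite cardsD (setIidPr sX) cA cX; move: lem k3; clear; nia.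
  have vXY := nbr_notin vS.
  have {}vA : v \notin A.
    by move: vA vXY; rewrite in_setD in_setU; case: (v \in X) => //=; case: (v \in A).
  have eX : (v |: (X :|: Y)) :&: A = X.
    apply/setP=> x; rewrite in_setI !in_setU1 in_setU.
    case: eqVneq => [->|_] /=.
      by rewrite (negPf vA); apply/esym/negP=> /(subsetP sX); rewrite (negPf vA).
    case xA: (x \in A); rewrite ?andbF ?andbT.
      case xY: (x \in Y); rewrite ?orbF //.
      by have := subsetP sY _ xY; rewrite in_setC xA.
    by apply/esym/negP=> /(subsetP sX); rewrite xA.
  exists (v |: (X :|: Y)); rewrite eX cX leqnn nbr_edge //=; split=> //.
  by rewrite os.
have half0 := odd_double_half #|e0 :&: A|; rewrite (negPf e0A) add0n in half0.
set j0 := #|e0 :&: A|./2 in half0.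
(* The edge [e0] has excess [2 * j0 - 1], and each edge with three vertices in [A] adds 2, for a
   total of [s]. *)
have [||N [sN tN cN dN hN]] := @greedy_matching V H k kH k0 (k * s.+1)
    (fun e => #|e :&: A| == 3) (s./2.+1 - j0) e0.
- rewrite (kH e0H) -{1}[k]muln1 -mulnDr leq_mul2l; apply/orP; right.
  by move: half2; rewrite -muln2 /=; clear; lia.
- exact: h3.
have e0N : [disjoint e0 & cover N] by rewrite disjoint_sym.
have e0N' := notin_disjoint_cover (e := e0) (M := N); rewrite (kH e0H) in e0N'.
have lej : j0 <= s./2.+1 by move: le0 half0 half2; rewrite -!muln2 /=; clear; lia.
exists (e0 |: N); split.
- by rewrite subUset sub1set e0H.
- exact: trivIset_setU1.
- by rewrite cardsU1 e0N' // cN; move: half2; rewrite -muln2; clear; lia.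
- rewrite card_coverI; last exact: trivIset_setU1.
  rewrite big_setU1 ?e0N' //= -card_coverI // sum3 // cardsU1 e0N' // cN.
  by move: half0 half2 lej; rewrite -!muln2 /=; clear; lia.
Qed.

(** Suppose that a maximum matching [M] inside [B :|: Q] has fewer than [r] edges, and take [n]
    disjoint [(k-1)]-subsets of [B] off [M]. Each has at least [r] neighbours in [B :|: Q]; by
    independence and maximality they lie in [Q :&: cover M]. But [q] in [Q] is a neighbour only of
    sets meeting [Zs q], at most [h] of the [n], so [n * r <= #|M| * k * h <= #|M| * n], which is
    impossible. *)
Lemma deficit_matching B (Q : {set V}) (Zs : V -> {set V}) (r h n : nat) :
  (forall e, e \in H -> ~~ (e \subset B)) -> [disjoint Q & B] ->
  (forall q, q \in Q -> #|Zs q| <= h) ->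
  (forall q T, q \in Q -> T \subset B -> [disjoint T & Zs q] -> #|T| = k.-1 ->
    q \notin nbr H T) ->
  #|~: (B :|: Q)| + r = m -> 0 < n -> k * h <= n -> n * k.-1 + k * r <= #|B| ->
  exists M, [/\ M \subset H, trivIset M, #|M| = r & cover M \subset B :|: Q].
Proof.
move=> indep dQB hZ hbad cA2 n0 len leB.
have k0 : 0 < k by apply: ltnW (ltnW k3).
have k10 : 0 < k.-1 by move: k3; case: k => [|[]].
pose E := [set e in H | e \subset B :|: Q].
have sE : E \subset H by apply/subsetP=> e; rewrite inE => /andP[].
have E0 e : e \in E -> 0 < #|e| by move/(subsetP sE)/kH->.
have [M [sM tM mM meet]] := ex_maximum_matching E0.
have [/exists_subset_card[M' sM' cM']|ltM] := leqP r #|M|.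
  exists M'; split=> //; first exact: subset_trans sM' (subset_trans sM sE).
    exact: trivIsetS tM.
  by apply: cover_sub => e /(subsetP sM')/(subsetP sM); rewrite inE => /andP[].
exfalso.
have cC : #|cover M| = #|M| * k by rewrite (matching_card kH _ tM) ?(subset_trans sM).
have [|F [tF cF sF hF]] := @disjoint_family V (B :\: cover M) k.-1 n k10.
  rewrite cardsD; have := subset_leq_card (subsetIr B (cover M)); rewrite cC.
  have : #|M| * k <= k * r by rewrite mulnC leq_mul2l ltnW ?orbT.
  move: leB; move: (n * k.-1) (k * r) #|B| #|B :&: _| (#|M| * k) => a b c d e; clear; lia.
have sTB T : T \in F -> T \subset B.
  by move=> TF; apply: subset_trans (sub_cover TF) (subset_trans sF (subsetDl _ _)).
have dTC T : T \in F -> [disjoint T & cover M].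
  move=> TF; have := subset_trans (sub_cover TF) sF.
  by rewrite subsetD => /andP[].
have dc := double_count F (Q :&: cover M) (fun T q => q \in nbr H T).
have l : n * r <= \sum_(T in F) #|[set q in Q :&: cover M | q \in nbr H T]|.
  rewrite -cF -sum_nat_const; apply: leq_sum => T TF.
  rewrite -(leq_add2l #|~: (B :|: Q)|) cA2; apply: leq_trans (hdeg (hF _ TF)) _.
  apply: leq_trans (leq_card_setU _ _).1; apply: subset_leq_card.
  apply/subsetP=> v vT; rewrite in_setU in_setC in_set vT andbT in_setU in_setI.
  have vB : v \notin B.
    apply: contra (indep _ (nbr_edge vT)) => vB.
    by rewrite subUset sub1set vB sTB.
  rewrite (negPf vB) /=; case vQ: (v \in Q) => //=; apply/negPn/negP=> vC.
  have /meet/negP[] : v |: T \in E.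
    rewrite inE nbr_edge //= subUset sub1set in_setU vQ orbT /=.
    by rewrite (subset_trans (sTB _ TF)) ?subsetUl.
  apply/disjointP=> x; rewrite in_setU1 => /orP[/eqP->//|].
  exact: (disjointP _ _ (dTC _ TF)).
have u : \sum_(q in Q :&: cover M) #|[set T in F | q \in nbr H T]| <= #|M| * k * h.
  rewrite -cC; apply: leq_trans (_ : \sum_(q in Q :&: cover M) h <= _).
    apply: leq_sum => q; rewrite in_setI => /andP[qQ _].
    apply: leq_trans (hZ _ qQ); apply: leq_trans (card_meeting (Zs q) tF).
    apply: subset_leq_card; apply/subsetP=> T; rewrite !in_set => /andP[TF] /andP[qT qH].
    rewrite TF /=; apply/negP=> d; have := hbad q T qQ (sTB _ TF) d (hF _ TF).
    by rewrite inE qT qH.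
  by rewrite sum_nat_const leq_mul2r subset_leq_card ?orbT ?subsetIr.
have := leq_trans l (eq_leq dc); move/leq_trans/(_ u).
move: ltM len n0; move: #|M| => a; clear; nia.
Qed.

Lemma extremal_perfect_matching B s :
  (forall e, e \in H -> ~~ (e \subset B)) -> #|~: B| <= m + s ->
  20 * (k * k) * s.+1 <= m -> ~ parity_family k H ->
  has_perfect_matching H.
Proof.
move=> indep leA lem hpar.
have k0 : 0 < k by apply: ltnW (ltnW k3).
have k10 : 0 < k.-1 by move: k3; case: k => [|[]].
have m0 : 0 < m by apply: leq_trans lem; rewrite !muln_gt0 k0.
set A := ~: B in leA.
have cAB : #|A| + #|B| = k * m by rewrite -cV addnC; apply: cardsC.
have f1 : 9 * s.+1 <= k * k * s.+1 by rewrite leq_mul2r (@leq_mul 3 3).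
have f2 : 3 * k * s.+1 <= k * k * s.+1 by rewrite leq_mul2r leq_mul2r k3 orbT.
have codeg T : T \subset B -> #|T| = k.-1 -> #|A :\: nbr H T| <= s.
  move=> sT cT; rewrite cardsD (setIidPr _).
    have := hdeg cT; move: leA; move: #|A| #|nbr H T| => a b; clear; lia.
  apply/subsetP=> v vT; rewrite in_setC; apply: contra (indep _ (nbr_edge vT)) => vB.
  by rewrite subUset sub1set vB.
have leA' : m <= #|A|.
  have [|T sT cT] := @exists_subset_card V B k.-1.
    move: cAB leA lem f1 f2 k3; move: #|A| #|B| => a b; clear.
    case: k => [|[|[|k']]] //=; nia.
  apply: leq_trans (hdeg cT) _; apply: subset_leq_card; apply/subsetP=> v vT.
  rewrite in_setC; apply: contra (indep _ (nbr_edge vT)) => vB.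
  by rewrite subUset sub1set vB.
(* Room for the vertices of [M], at most [k * (4 * s + 1)], together with the [k * (2 * s)] that
   [balanced_pm] may forbid. *)
pose h := k * (6 * s + 2).
pose avoids a Z T := [&& T \subset B, [disjoint T & Z], #|T| == k.-1 & a \in nbr H T].
(* Bad vertices: those whose links inside [B] are destroyed by few vertices.
   A [(k-1)]-subset of [B] misses at most [s] vertices of [A], so there are at most [2 * s]. *)
pose good a := [forall Z : {set V}, (#|Z| <= h) ==> [exists T, avoids a Z T]].
pose Q := [set a in A | ~~ good a].
pose Zs a := odflt set0 [pick Z : {set V} | (#|Z| <= h) && ~~ [exists T, avoids a Z T]].
have ZsP q : q \in Q -> #|Zs q| <= h /\ forall T, ~~ avoids q (Zs q) T.
  rewrite inE => /andP[_]; rewrite negb_forall => /existsP[Z].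
  rewrite negb_imply /Zs; case: pickP => [Z' /andP[h1 h2] _|/(_ Z) -> //]; split=> // T.
  by apply: contra h2 => h2; apply/existsP; exists T.
have sQA : Q \subset A by apply/subsetP=> q; rewrite inE => /andP[].
have dQB : [disjoint Q & B] by rewrite disjoints_subset.
have hZ q : q \in Q -> #|Zs q| <= h by case/ZsP.
have hbad q T : q \in Q -> T \subset B -> [disjoint T & Zs q] -> #|T| = k.-1 ->
    q \notin nbr H T.
  by case/ZsP=> _ hT sT dT cT; have := hT T; rewrite /avoids sT dT cT eqxx.
have cQ : #|Q| <= 2 * s.
  pose N := m - s.
  have [|F [tF cF sF hF]] := @disjoint_family V B k.-1 N k10.
    rewrite /N; move: cAB leA lem k3; move: #|A| #|B| => a b; clear.
    case: k => [|k'] //= ; nia.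
  apply: (@half_count _ N h).
  - rewrite /N; move: lem f1 f2; clear; lia.
  - rewrite /N /h; move: lem f1 f2; clear; lia.
  apply: leq_trans (_ : \sum_(T in F) #|[set a in Q | a \notin nbr H T]| <= _); last first.
    rewrite -cF -sum_nat_const; apply: leq_sum => T TF.
    have sTB : T \subset B by apply: subset_trans sF; apply: sub_cover.
    apply: leq_trans (codeg T sTB (hF _ TF)).
    apply: subset_leq_card; apply/subsetP=> a; rewrite in_set in_setD => /andP[aQ ->].
    exact: (subsetP sQA).
  rewrite (double_count F Q (fun T a => a \notin nbr H T)) -sum_nat_const.
  apply: leq_sum => q qQ; rewrite leq_subLR.
  have sub : F \subset [set T in F | ~~ [disjoint T & Zs q]] :|: [set T in F | q \notin nbr H T].
    apply/subsetP=> T TF; rewrite in_setU in_set [X in _ || X]in_set TF /=.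
    case d: [disjoint T & Zs q] => //=; apply: hbad => //; last exact: hF.
    by apply: subset_trans sF; apply: sub_cover.
  have := leq_trans (subset_leq_card sub) (leq_card_setU _ _).1; rewrite cF => /leq_trans.
  by apply; rewrite leq_add2r; apply: leq_trans (card_meeting _ tF) (hZ _ qQ).
(* Bad vertices behave like vertices of [B]: the balance is computed for [A2], and all of [Q] is
   covered before [balanced_pm] is applied. *)
pose A2 := A :\: Q.
have eA2 : ~: (B :|: Q) = A2 by rewrite /A2 /A; clear; set_solve.
have cA2 : #|A2| = #|A| - #|Q| by rewrite cardsD (setIidPr sQA).
have [M0 [sM0 tM0 cM0 bal]] : exists M0, [/\ M0 \subset H, trivIset M0,
    #|M0| <= (2 * s).+1 & #|cover M0 :&: A2| + m = #|M0| + #|A2|].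
  have [leA2|ltA2] := leqP m #|A2|.
    have [||odds|M [sM tM cM cMA]] := @surplus_matching A2 (#|A2| - m).
    - by rewrite subnKC.
    - rewrite cA2; move: leA leA' lem f1 f2; move: #|A| #|Q| => a q; clear; nia.
    - have [e /andP[eH eo]|hno] := pickP (fun e => (e \in H) && ~~ odd #|e :&: A2|).
        by exists e.
      (* If every edge meets [A2] in an odd number of vertices and [#|A2| - m] is odd, then [A2] is
         the set [X] that puts [H] into the parity family. *)
      case: hpar; split=> //; first by rewrite cV dvdn_mulr.
      exists A2; split.
        rewrite cV mulKn //; have -> : absz (m%:Z - #|A2|%:Z)%R = #|A2| - m by lia.
        by [].
      move=> e eH; have := hno e; rewrite eH /= => /negbFE //.
    exists M; split=> //.
      apply: leq_trans cM _; rewrite ltnS cA2; move: leA; move: #|A| #|Q| => a q; clear; lia.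
    by rewrite cMA; move: leA2; clear; lia.
  (* Removing [Q] has made [A2] too small; each edge inside [B :|: Q] spends no vertex of [A2], so
     [m - #|A2|] of them restore the balance. *)
  have [||||M [sM tM cM coM]] := @deficit_matching B Q Zs (m - #|A2|) h (m - s - 2 * s * k) indep dQB hZ hbad.
  - by rewrite eA2 subnKC // ltnW.
  - move: lem f1 f2; clear; lia.
  - rewrite /h; move: lem f1 f2; clear; lia.
  - have ler : m - #|A2| <= 2 * s.
      rewrite cA2; move: leA' cQ; move: #|A| #|Q| => a q; clear; lia.
    have : k * (m - #|A2|) <= k * (2 * s) by rewrite leq_mul2l ler orbT.
    move: cAB leA lem k3; move: #|A| #|B| (m - #|A2|) => a b r; clear.
    case: k => [|k'] //=; nia.
  exists M; split=> //.
    rewrite cM cA2; move: leA' cQ; move: #|A| #|Q| => a q; clear; lia.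
  rewrite (_ : cover M :&: A2 = set0) ?cards0 ?cM; first by move: ltA2; clear; lia.
  by move: coM; rewrite -eA2; clear; move=> ?; set_solve.
have ccM0 := matching_card kH sM0 tM0.
(* Edges with exactly one vertex in [A2] leave the balance reached by [M0] unchanged. *)
pose P e := #|e :&: A2| == 1.
have [||y W' yY leW yW'|M1 [sM1 tM1 cM1 coM1 [dM1 PM1]]] :=
    @greedy_cover V H k kH k0 (k * (4 * s + 1)) P (Q :\: cover M0) (cover M0).
- by clear; set_solve.
- rewrite ccM0; have : #|Q :\: cover M0| <= 2 * s.
    by apply: leq_trans cQ; apply: subset_leq_card; apply: subsetDl.
  move: cM0; move: #|M0| #|Q :\: _| => a b; clear; nia.
- have yQ : y \in Q by move: yY; rewrite in_setD => /andP[].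
  have yB : y \notin B by rewrite (disjointFr dQB yQ).
  pose W1 := W' :|: Zs y.
  have cW1 : #|W1| <= k * (4 * s + 1) + h.
    by apply: leq_trans (leq_card_setU _ _).1 (leq_add leW (hZ _ yQ)).
  have [|X [sX dX cX]] := @exists_avoiding B W1 k.-2.
    move: cW1 cAB leA lem f1 f2 k3; rewrite /h; move: #|W1| #|A| #|B| => w a b; clear.
    case: k => [|[|[|k']]] //=; nia.
  have yX : y \notin X by apply: contra yB => /(subsetP sX).
  have cS : #|y |: X| = k.-1.
    by rewrite cardsU1 yX cX; move: k3; case: k => [|[]].
  (* This neighbour must lie in [A2]: were it in [B], the set [v |: X] would be a [(k-1)]-subset of
     [B] that avoids [Zs y] and has [y] as a neighbour. *)
  have [|v vS vW] := @exists_notin (nbr H (y |: X)) (W1 :|: Q).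
    apply: leq_trans (hdeg cS); apply: leq_ltn_trans (leq_card_setU _ _).1 _.
    apply: leq_ltn_trans (leq_add cW1 cQ) _.
    rewrite /h; move: lem f1 f2 k3; clear; nia.
  move: vW; rewrite !in_setU !negb_or => /andP[/andP[vW vZ] vQ].
  have vyX := nbr_notin vS.
  have vy : v != y by apply: contraNneq vyX => ->; apply: setU11.
  have vX : v \notin X by apply: contra vyX => vX; rewrite in_setU1 vX orbT.
  have vB : v \notin B.
    apply/negP=> vB; have := hbad y (v |: X) yQ.
    rewrite subUset sub1set vB sX cardsU1 vX cX.
    have -> : [disjoint v |: X & Zs y].
      apply/disjointP=> x; rewrite in_setU1 => /orP[/eqP->//|xX].
      by have := disjointFr dX xX; rewrite in_setU => /norP[].
    have -> : true + k.-2 = k.-1 by move: k3; case: k => [|[]].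
    move=> /(_ isT isT (erefl _))/negP[]; rewrite in_set in_setU1 negb_or eq_sym vy yX /=.
    by move: (nbr_edge vS); rewrite setUCA.
  have vA2 : v \in A2 by rewrite in_setD vQ in_setC vB.
  exists (v |: (y |: X)); split; first exact: nbr_edge.
  + apply/cards1P; exists v; apply/setP=> x; rewrite in_setI !in_setU1 in_set1.
    case: eqVneq => [->|_] /=; first by rewrite vA2.
    apply/negP=> /andP[/orP[/eqP->|/(subsetP sX) xB]]; rewrite in_setD in_setC.
      by rewrite yQ.
    by rewrite xB andbF.
  + by rewrite !in_setU1 eqxx orbT.
  + apply/disjointP=> x; rewrite !in_setU1 => /or3P[/eqP->//|/eqP->//|xX].
    by have := disjointFr dX xX; rewrite in_setU => /norP[].
have ccM1 := matching_card kH sM1 tM1.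
pose M := M0 :|: M1.
have dM01 : [disjoint cover M0 & cover M1] by rewrite disjoint_sym.
have coM : cover M = cover M0 :|: cover M1 by apply: cover_setU.
have tM : trivIset M by apply: trivIsetU.
have sM : M \subset H by rewrite subUset sM0.
have ccM : #|cover M| = (#|M0| + #|M1|) * k.
  by rewrite coM card_disjointU // ccM0 ccM1 mulnDl.
have cM1A : #|cover M1 :&: A2| = #|M1|.
  by rewrite card_coverI // -sum1_card; apply: eq_bigr => e /PM1/eqP.
have cMA : #|cover M :&: A2| + m = #|M0| + #|M1| + #|A2|.
  rewrite coM setIUl card_disjointU ?cM1A; first by move: bal; clear; lia.
  by clear -dM01; set_solve.
have leM1 : #|M1| <= 2 * s.
  by apply: leq_trans cM1 (leq_trans _ cQ); apply: subset_leq_card (subsetDl _ _).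
have sQM : Q \subset cover M by rewrite coM; clear -coM1; set_solve.
have leM : k * (#|M0| + #|M1|) <= k * (4 * s + 1).
  by rewrite leq_mul2l; apply/orP; right; move: cM0 leM1; clear; lia.
pose A' := A2 :\: cover M; pose B' := B :\: cover M.
pose p := m - (#|M0| + #|M1|).
have lep : #|M0| + #|M1| <= 4 * s + 1 by move: cM0 leM1; clear; lia.
have cA' : #|A'| = p.
  by rewrite cardsD setIC /p; move: cMA (subset_leq_card (subsetIr (cover M) A2)); clear; lia.
have dA'B' : [disjoint A' & B'] by rewrite /A' /B' /A2 /A; clear; set_solve.
have eAB' : A' :|: B' = ~: cover M.
  by move: sQM; rewrite /A' /B' /A2 /A; clear; move=> ?; set_solve.
have cB' : #|B'| = k.-1 * p.
  have := card_disjointU dA'B'; rewrite eAB' card_setC ccM cA' /p.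
  move: lem lep k3; move: #|B'| (#|M0| + #|M1|) => b c; clear.
  case: k => [|k'] //= h1 h2 _ h3.
  by nia.
have pmAB : induced_has_perfect_matching H (A' :|: B').
  apply: (@balanced_pm V H k kH k3 A' B' p s (k * (2 * s))) => //.
  - move=> T sT cT; apply: leq_trans (codeg T _ cT).
      by apply: subset_leq_card; rewrite /A' /A2; move: (nbr H T) => X; clear; set_solve.
    by apply: subset_trans sT (subsetDl _ _).
  - move=> a W; rewrite !in_setD => /andP[aM /andP[aQ aA]] leW.
    have : good a by move: aQ; rewrite inE aA /= negbK.
    move/forallP/(_ (W :|: cover M)); rewrite (_ : #|_| <= h) /=.
      case/existsP=> T /and4P[sT dT /eqP cT aT]; exists T; split=> //.
        by clear -sT dT; rewrite /B'; set_solve.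
      by clear -dT; set_solve.
    apply: leq_trans (leq_card_setU _ _).1 _; rewrite ccM mulnC /h.
    by move: leW leM; clear; lia.
  - rewrite /p; move: lem lep f1 f2; move: (#|M0| + #|M1|) => c; clear; nia.
apply: has_pmE; rewrite (_ : [set: V] = cover M :|: (A' :|: B')); last first.
  by rewrite eAB' setUCr.
apply: induced_pmU => //; last exact: matching_pm.
by rewrite eAB' disjoints_subset setCK.
Qed.

End Extremal.

Local Open Scope ring_scope.

(** * Lattices of index vectors *)

(** An unbundled [zmod_closed], stated for plain predicates so that membership coercions stay
    confined to [is_latticeP]. *)
Definition is_lattice (d : nat) (L : 'rV[int]_d -> Prop) : Prop :=
  L 0 /\ forall x y, L x -> L y -> L (x - y).

Section Lattices.
Variable d : nat.
Implicit Types (L P : 'rV[int]_d -> Prop) (x y z v : 'rV[int]_d).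

Lemma is_latticeN L x : is_lattice L -> L x -> L (- x).
Proof. by case=> L0 LB Lx; rewrite -sub0r; apply: LB. Qed.

Lemma is_latticeD L x y : is_lattice L -> L x -> L y -> L (x + y).
Proof. by move=> lL Lx Ly; rewrite -[y]opprK; case: (lL) => _; apply=> //; apply: is_latticeN. Qed.

Lemma is_lattice_sum L (T : Type) (r : seq T) (p : pred T) (F : T -> 'rV[int]_d) :
  is_lattice L -> (forall i, p i -> L (F i)) -> L (\sum_(i <- r | p i) F i).
Proof.
move=> lL h; apply: (big_ind L) => //; first by case: lL.
by move=> x y; apply: is_latticeD.
Qed.

Lemma is_latticeMz L x (n : int) : is_lattice L -> L x -> L (x *~ n).
Proof.
move=> lL Lx; have Ln m : L (x *+ m).
  elim: m => [|m IH]; first by rewrite mulr0n; case: lL.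
  by rewrite mulrS; apply: is_latticeD.
case: n => m; first exact: Ln.
by rewrite NegzE mulrNz; apply: is_latticeN => //; apply: Ln.
Qed.

Lemma is_latticeP L : is_lattice L <-> zmod_closed [in (L : classical_sets.set 'rV[int]_d)].
Proof.
split=> [[L0 LB]|[L0 LB]]; split.
- exact: (classical_sets.mem_set L0).
- by move=> x y Lx Ly; apply: classical_sets.mem_set (LB _ _ _ _); apply: classical_sets.set_mem.
- exact: (classical_sets.set_mem L0).
- by move=> x y Lx Ly; apply: classical_sets.set_mem (LB x y _ _); apply: classical_sets.mem_set.
Qed.

Lemma lattice_generated_min L P v : is_lattice P -> (forall x, L x -> P x) ->
  lattice_generated L v -> P v.
Proof.
by move=> lP LP gv; apply: (gv P); split; [exact: (is_latticeP P).1 | exact: LP].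
Qed.

Lemma sub_lattice_generated L v : L v -> lattice_generated L v.
Proof. by move=> Lv A [_]; apply. Qed.

Lemma lattice_generated_is_lattice L : is_lattice (lattice_generated L).
Proof.
split=> [|x y Lx Ly] A [zA sA]; have [A0 AB] := (is_latticeP A).2 zA => //.
by apply: AB; [apply: Lx | apply: Ly].
Qed.

End Lattices.

(** * Classes modulo a full lattice and zero-sum subfamilies *)

Section Zero_sum.
Variables (d k : nat) (L : 'rV[int]_d -> Prop).
Hypothesis lL : is_lattice L.
Hypothesis fullL : full_lattice k L.
Hypothesis k3 : (2 < k)%N.
Hypothesis d0 : (0 < d)%N.
Implicit Types (x y z v w : 'rV[int]_d).

Definition coord_sum v : int := \sum_j v 0 j.

Lemma coord_sumD v w : coord_sum (v + w) = coord_sum v + coord_sum w.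
Proof. by rewrite /coord_sum -big_split; apply: eq_bigr => j _; rewrite mxE. Qed.

Lemma coord_sumN v : coord_sum (- v) = - coord_sum v.
Proof. by rewrite /coord_sum -sumrN; apply: eq_bigr => j _; rewrite mxE. Qed.

Lemma coord_sumMn v n : coord_sum (v *+ n) = coord_sum v *+ n.
Proof.
elim: n => [|n IH]; last by rewrite !mulrS coord_sumD IH.
by rewrite !mulr0n /coord_sum big1 // => j _; rewrite mxE.
Qed.

Lemma coord_sumMz v (n : int) : coord_sum (v *~ n) = coord_sum v *~ n.
Proof.
case: n => n; first exact: coord_sumMn.
by rewrite NegzE !mulrNz coord_sumN; congr (- _); apply: coord_sumMn.
Qed.

Lemma coord_sum_unit (i : 'I_d) : coord_sum (unit_vector i) = 1.
Proof.
rewrite /coord_sum (bigD1 i) //= mxE !eqxx big1 ?addr0 // => j ne.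
by rewrite mxE eqxx (negPf ne).
Qed.

Lemma unit_vector_ge0 (i j : 'I_d) : 0 <= unit_vector i 0 j :> int.
Proof. by rewrite mxE; case: (_ && _). Qed.

Let o : 'I_d := Ordinal d0.

Lemma full_completion v : rvector k.-1 v -> exists i, L (v + unit_vector i).
Proof. by case: fullL => [[I [_ hI] IL] _] /hI[i /IL]; exists i. Qed.

Lemma unit_vector_exchange (i j l : 'I_d) :
  exists b, L (unit_vector i + unit_vector j - unit_vector l - unit_vector b).
Proof.
have rv i1 i2 : rvector k.-1 (unit_vector i1 + unit_vector i2 + unit_vector o *+ (k - 3)).
  split=> [t|].
    rewrite !mxE mulmxnE mxE; do ?apply: addr_ge0; rewrite ?ler0n //.
    by rewrite mulrn_wge0 ?ler0n.
  rewrite -[LHS]/(coord_sum _) !coord_sumD coord_sumMn !coord_sum_unit.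
  by move: k3; clear; lia.
have [a La] := full_completion (rv i j).
have [b Lb] := full_completion (rv a l).
exists b; have := lL.2 _ _ La Lb; congr L.
by apply/matrixP=> s t; rewrite !mxE; ring.
Qed.

(* Vectors of a given coordinate sum thus fall into at most [d] classes. *)
Lemma lattice_class z :
  exists c, L (z - unit_vector o *~ coord_sum z - (unit_vector c - unit_vector o)).
Proof.
pose G z := exists c, L (z - unit_vector o *~ coord_sum z - (unit_vector c - unit_vector o)).
(* [G] holds at all unit vectors, so closure under differences makes it hold everywhere;
   [unit_vector_exchange] merges two class representatives into one. *)
have lG : is_lattice G.
  split=> [|x y [c Lc] [c' Lc']].
    exists o; rewrite subrr subr0 sub0r (_ : coord_sum 0 = 0) ?mulr0z ?oppr0; first by case: lL.
    by rewrite /coord_sum big1 // => j _; rewrite mxE.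
  have [b Lb] := unit_vector_exchange c o c'; exists b.
  have := is_latticeD lL (lL.2 _ _ Lc Lc') Lb; congr L.
  rewrite coord_sumD coord_sumN mulrzDr mulrNz.
  by move: (_ *~ _) (_ *~ _) => p q; apply/matrixP=> s t; rewrite !mxE; ring.
have Gu i : G (unit_vector i).
  by exists i; rewrite coord_sum_unit mulr1z subrr; case: lL.
change (G z); rewrite [z]row_sum_delta; apply: is_lattice_sum => // j _.
by rewrite -[X in X *: _]intz scaler_int; apply: is_latticeMz => //; apply: Gu.
Qed.

(** A [k]-vector [q] of [L] is subtracted [t] times, which reduces to coordinate sum zero without
    changing the class. *)
Lemma lattice_class_mod z t : coord_sum z = k%:Z * t ->
  exists c, L (z - (unit_vector c - unit_vector o)).
Proof.
move=> sz; have [|b Lb] := @full_completion (unit_vector o *+ k.-1).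
  split=> [j|]; last by rewrite -[LHS]/(coord_sum _) coord_sumMn coord_sum_unit natz.
  by rewrite mulmxnE mulrn_wge0 ?unit_vector_ge0.
set q := (X in L X) in Lb.
have sq : coord_sum q = k%:Z.
  rewrite coord_sumD coord_sumMn !coord_sum_unit.
  by move: k3; clear; lia.
have [c Lc] := lattice_class (z - q *~ t); exists c.
have := is_latticeD lL Lc (is_latticeMz t lL Lb); congr L.
rewrite coord_sumD coord_sumN coord_sumMz sq sz.
have -> : k%:Z * t - k%:Z *~ t = 0 by rewrite mulrzz subrr.
by rewrite mulr0z subr0 addrAC subrK.
Qed.

(** Pigeonhole on prefix sums: as long as [A] has at least [d] elements, two of its [d + 1] prefixes
    (the empty one included) fall into the same of [d] classes. The block between them sums into [L]
    and can be removed. *)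
Lemma zero_sum_subset (T : finType) (x : T -> 'rV[int]_d) (A : {set T}) :
  (forall i, i \in A -> exists t, coord_sum (x i) = k%:Z * t) ->
  exists B : {set T}, [/\ B \subset A, (#|B| < d)%N & L (\sum_(i in A :\: B) x i)].
Proof.
have [n] := ubnP #|A|; elim: n A => // n IH A leA hx.
have [lt|ge] := ltnP #|A| d.
  by exists A; split=> //; rewrite setDv big_set0; case: lL.
pose S (j : 'I_d.+1) := [set:: take j (enum A)].
have sS j : S j \subset A.
  by apply/subsetP=> i; rewrite inE => /mem_take; rewrite mem_enum.
have cS j : #|S j| = j.
  rewrite cardsE (card_uniqP _) ?take_uniq ?enum_uniq // size_take -cardE.
  by have := leq_trans (ltn_ord j : (j <= d)%N) ge; case: ltngtP.
have cls j : exists c, L (\sum_(i in S j) x i - (unit_vector c - unit_vector o)).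
  have [t ht] : exists t, coord_sum (\sum_(i in S j) x i) = k%:Z * t.
    apply: (big_ind (fun v => exists t, coord_sum v = k%:Z * t)).
    - by exists 0; rewrite mulr0 /coord_sum big1 // => i _; rewrite mxE.
    - by move=> v w [s hs] [t ht]; exists (s + t); rewrite coord_sumD hs ht mulrDr.
    - by move=> i /(subsetP (sS j))/hx.
  exact: lattice_class_mod ht.
have [c Lc] := fin_all_exists cls.
have : ~~ injectiveb c.
  apply/negP=> /injectiveP/leq_card; rewrite !card_ord.
  by rewrite ltnn.
case/injectivePn=> j1 [j2 ne ec].
wlog lt : j1 j2 ne ec / (j1 < j2)%N.
  move=> h; case: (ltngtP j1 j2) => [|lt|/ord_inj e]; first exact: h.
    by apply: (h j2 j1) => //; rewrite eq_sym.
  by rewrite e eqxx in ne.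
have sS12 : S j1 \subset S j2.
  apply/subsetP=> i; rewrite !inE => h.
  by rewrite -(subnKC (ltnW lt)) takeD mem_cat h.
pose A0 := S j2 :\: S j1.
have sA0 : A0 \subset A by apply: subset_trans (subsetDl _ _) (sS j2).
have cA0 : (0 < #|A0|)%N by rewrite cardsD (setIidPr sS12) !cS subn_gt0.
have LA0 : L (\sum_(i in A0) x i).
  have := lL.2 _ _ (Lc j2) (Lc j1); rewrite ec; congr L.
  rewrite (big_setID (S j1)) /= (setIidPr sS12).
  move: (unit_vector (c j2) - _) => w; by rewrite opprB addrA subrK addrAC subrr add0r.
have [||B [sB cB LB]] := IH (A :\: A0).
- rewrite cardsD (setIidPr sA0); have := subset_leq_card sA0.
  by move: leA cA0; move: #|A| #|A0| => a b; clear; lia.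
- by move=> i; rewrite inE => /andP[_ /hx].
have sBA : B \subset A by apply: subset_trans sB (subsetDl _ _).
exists B; split=> //; rewrite (big_setID A0) /=; apply: is_latticeD => //.
  have -> : (A :\: B) :&: A0 = A0.
    apply/setIidPr/subsetP=> i iA0; rewrite in_setD (subsetP sA0) // andbT.
    by apply/negP=> /(subsetP sB); rewrite in_setD iA0.
  by [].
by have <- : (A :\: A0) :\: B = (A :\: B) :\: A0 by apply/setP=> i; rewrite !in_setD andbCA.
Qed.

End Zero_sum.

(** * Bounded representations by generators *)

Section Bounded_representation.

Lemma lattice_generated_lists d (I : 'rV[int]_d -> Prop) v : lattice_generated I v ->
  exists a b : seq 'rV[int]_d, [/\ forall x, x \in a -> I x, forall x, x \in b -> I x &
    v + \sum_(x <- b) x = \sum_(x <- a) x].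
Proof.
move: v; pose P v := exists a b : seq 'rV[int]_d, [/\ forall x, x \in a -> I x,
  forall x, x \in b -> I x & v + \sum_(x <- b) x = \sum_(x <- a) x].
move=> v; apply: (@lattice_generated_min _ _ P) => [|x Ix]; last first.
  exists [:: x], [::]; split=> // [y|]; first by rewrite inE => /eqP->.
  by rewrite big_nil big_seq1 addr0.
split=> [|x y [a [b [ha hb e]]] [a' [b' [ha' hb' e']]]].
  by exists [::], [::]; split=> //; rewrite !big_nil addr0.
exists (a ++ b'), (b ++ a'); split.
- by move=> z; rewrite mem_cat => /orP[/ha|/hb'].
- by move=> z; rewrite mem_cat => /orP[/hb|/ha'].
rewrite !big_cat /= -e -e'; move: (\sum_(_ <- b) _) (\sum_(_ <- b') _) => p q.
by apply/matrixP=> s t; rewrite !mxE; ring.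
Qed.

Definition bounded_lists d (I : 'rV[int]_d -> Prop) (n : nat) v : Prop :=
  exists a b : seq 'rV[int]_d, [/\ forall x, x \in a -> I x, forall x, x \in b -> I x,
    (size a <= n)%N, (size b <= n)%N & v + \sum_(x <- b) x = \sum_(x <- a) x].

(* Only finitely many pairs (generators, vector) occur, whence a uniform bound. *)
Lemma bounded_representation (k c d : nat) : exists n,
  forall (I : 'rV[int]_d -> Prop), (forall v, I v -> rvector k v) ->
  forall v : 'rV[int]_d, (forall j, 0 <= v 0 j <= c%:Z) -> lattice_generated I v ->
  bounded_lists I n v.
Proof.
(* Coordinates of [k]-vectors lie between 0 and [k], so finite functions encode them, and the
   generating sets range over a finite type. *)
pose enc m (f : {ffun 'I_d -> 'I_m.+1}) : 'rV[int]_d := \row_j (f j : nat)%:Z.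
pose J (I : {set {ffun 'I_d -> 'I_k.+1}}) x := exists2 f, f \in I & x = enc k f.
have hb (phi : {set {ffun 'I_d -> 'I_k.+1}} * {ffun 'I_d -> 'I_c.+1}) :
    exists n, lattice_generated (J phi.1) (enc c phi.2) ->
      bounded_lists (J phi.1) n (enc c phi.2).
  have [/lattice_generated_lists[a [b [ha hb e]]]|no] :=
    pselect (lattice_generated (J phi.1) (enc c phi.2)); last by exists 0%N.
  by exists (size a + size b)%N => _; exists a, b; split; rewrite ?leq_addr ?leq_addl.
have [n hn] := fin_all_exists hb.
have encE m (v : 'rV[int]_d) : (forall j, 0 <= v 0 j <= m%:Z) -> exists f, v = enc m f.
  move=> hv; have hj j : exists i : 'I_m.+1, v 0 j = (i : nat)%:Z.
    have /andP[h1 h2] := hv j; have lt : (absz (v 0%R j) < m.+1)%N by lia.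
    by exists (Ordinal lt) => /=; lia.
  have [f hf] := fin_all_exists hj; exists (finfun f).
  by apply/rowP=> j; rewrite mxE ffunE hf.
exists (\max_phi n phi)%N => I hI v /encE[f ->] gv.
pose I' := [set f | `[< I (enc k f) >]].
have IJ x : I x <-> J I' x.
  split=> [Ix|[g gI ->]]; last by move: gI; rewrite inE => /asboolP.
  have [|g eg] := encE k x.
    move=> j; have [h0 hs] := hI _ Ix; rewrite h0 /= -hs (bigD1 j) //= lerDl.
    by apply: sumr_ge0.
  by exists g => //; rewrite inE; apply/asboolP; rewrite -eg.
have [|a [b [ha hb' sa sb e]]] := hn (I', f).
  apply: lattice_generated_min gv; first exact: lattice_generated_is_lattice.
  by move=> x /IJ; apply: sub_lattice_generated.
exists a, b; split=> //; try by move=> x xa; apply/IJ; auto.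
  exact: leq_trans sa (leq_bigmax (I', f)).
exact: leq_trans sb (leq_bigmax (I', f)).
Qed.

End Bounded_representation.

(** * Additivity of index vectors *)

Section Index_vectors.
Variables (V : finType) (d : nat) (P : d.-tuple {set V}).
Implicit Types (A B S : {set V}) (M : {set {set V}}).

Lemma index_vector0 : index_vector P set0 = 0.
Proof. by apply/rowP=> j; rewrite !mxE set0I cards0. Qed.

Lemma index_vectorU A B : [disjoint A & B] ->
  index_vector P (A :|: B) = index_vector P A + index_vector P B.
Proof.
move=> dAB; apply/rowP=> j; rewrite !mxE -PoszD; congr Posz.
rewrite setIUl; apply/eqP; rewrite (leq_card_setU _ _).2.
by clear -dAB; set_solve.
Qed.

Lemma index_vector_cover M : finset.trivIset M ->
  index_vector P (finset.cover M) = \sum_(e in M) index_vector P e.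
Proof.
have [n] := ubnP #|M|; elim: n M => // n IH M leM tM.
have [->|[e eM]] := set_0Vmem M; first by rewrite cover_set0 index_vector0 big_set0.
rewrite (big_setD1 e) //= -(setD1K eM) cover_setU1 index_vectorU.
  rewrite (setD1K eM) IH //; last exact: trivIsetS (subsetDl _ _) tM.
  by move: leM; rewrite (cardsD1 e) eM.
rewrite disjoint_sym; apply: disjoint_cover => e'; rewrite !inE => /andP[ne e'M].
exact: (trivIsetP tM).
Qed.

Lemma part_function : ordered_partition P ->
  exists p : V -> 'I_d, forall x j, (x \in tnth P j) = (j == p x).
Proof.
move=> [uP /and3P[/eqP cP tP nP]].
have hx x : exists j, x \in tnth P j.
  have : x \in finset.cover [set:: P] by rewrite cP inE.
  by case/bigcupP=> A; rewrite inE => /tnthP[j ->]; exists j.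
have [p hp] := fin_all_exists hx; exists p => x j.
apply/idP/eqP=> [xj|->//]; apply/eqP/negPn/negP=> ne.
have nA : tnth P j != tnth P (p x).
  by apply: contra ne => /eqP e; apply/eqP; apply: (tuple_uniqP P uP).
have := trivIsetP tP _ _ _ _ nA; rewrite !inE !mem_tnth => /(_ isT isT) dA.
by have := disjointFr dA xj; rewrite hp.
Qed.

Lemma coord_sum_index S : ordered_partition P -> coord_sum (index_vector P S) = #|S|%:Z.
Proof.
case/part_function=> p hp; rewrite /coord_sum.
rewrite (eq_bigr (fun j => Posz (\sum_(x in S) (j == p x))%N)); last first.
  move=> j _; rewrite mxE -sum1_card; congr Posz.
  rewrite big_mkcond [RHS]big_mkcond /=.
  by apply: eq_bigr => x _; rewrite in_setI hp; case: (x \in S); case: (j == p x).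
rewrite -(big_morph Posz PoszD (erefl _)) exchange_big /= -sum1_card; congr Posz.
apply: eq_bigr => x _; rewrite (bigD1 (p x)) //= eqxx big1 // => j /negPf-> //.
Qed.

End Index_vectors.

(** * Counting and gadgets *)

Section Counting.
Variable V : finType.

Lemma card_sets_le a : (#|[set T : {set V} | #|T| == a]| <= #|V| ^ a)%N.
Proof.
rewrite -card_tuple; apply: leq_trans (leq_imset_card (fun t : a.-tuple V => [set:: t]) _).
apply: subset_leq_card; apply/subsetP=> T; rewrite inE => /eqP cT.
have st : size (enum T) == a by rewrite -cardE cT.
apply/imsetP; exists (Tuple st) => //=.
by apply/setP=> x; rewrite inE mem_enum.
Qed.

Lemma card_sets_meeting_le a (Z : {set V}) : (0 < a)%N ->
  (#|[set T : {set V} | (#|T| == a) && ~~ [disjoint T & Z]]| <= #|Z| * #|V| ^ a.-1)%N.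
Proof.
move=> a0; pose F z := [set T : {set V} | (#|T| == a) && (z \in T)].
have sub : [set T : {set V} | (#|T| == a) && ~~ [disjoint T & Z]] \subset \bigcup_(z in Z) F z.
  apply/subsetP=> T; rewrite inE => /andP[cT]; rewrite -setI_eq0 => /set0Pn[z].
  by rewrite inE => /andP[zT zZ]; apply/bigcupP; exists z; rewrite // inE cT.
apply: leq_trans (subset_leq_card sub) _.
have : (#|\bigcup_(z in Z) F z| <= \sum_(z in Z) #|F z|)%N.
  apply: (big_ind2 (fun (X : {set {set V}}) n => #|X| <= n)%N) => [|X m Y n hX hY|//].
    by rewrite cards0.
  exact: leq_trans (leq_card_setU _ _).1 (leq_add hX hY).
move/leq_trans; apply.
rewrite -sum_nat_const; apply: leq_sum => z _.
apply: leq_trans (card_sets_le a.-1).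
rewrite -(card_in_imset (f := fun T : {set V} => T :\ z) (D := F z)); last first.
  move=> T T'; rewrite !inE => /andP[_ zT] /andP[_ zT'] e.
  by rewrite -(setD1K zT) -(setD1K zT') e.
apply: subset_leq_card; apply/subsetP=> _ /imsetP[T + ->]; rewrite !inE.
by case/andP=> /eqP cT zT; rewrite -cT (cardsD1 z T) zT.
Qed.

Lemma averaging (R : realFieldType) (I J : finType) (X : {set I}) (Y : {set J})
    (r : I -> J -> bool) (c : R) (n : nat) :
  X != set0 -> 0 < c -> (0 < n)%N -> (#|Y| <= n)%N ->
  (forall i, i \in X -> c * n%:R <= #|[set j in Y | r i j]|%:R) ->
  exists2 j, j \in Y & c * #|X|%:R <= #|[set i in X | r i j]|%:R.
Proof.
move=> X0 c0 n0 leY h.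
have [/existsP[j /andP[jY hj]]|no] :=
    boolP [exists j, (j \in Y) && (c * #|X|%:R <= #|[set i in X | r i j]|%:R)].
  by exists j.
exfalso; have X0' : 0 < #|X|%:R :> R by rewrite ltr0n card_gt0.
have lt j : j \in Y -> #|[set i in X | r i j]|%:R <= c * #|X|%:R :> R.
  move=> jY; rewrite leNgt; apply: contra no => /ltW le.
  by apply/existsP; exists j; rewrite jY.
have l : #|X|%:R * (c * n%:R) <= (\sum_(i in X) #|[set j in Y | r i j]|)%N%:R :> R.
  by rewrite natr_sum mulr_natl -sumr_const; apply: ler_sum.
have u : (\sum_(j in Y) #|[set i in X | r i j]|)%N%:R <= #|Y|%:R * (c * #|X|%:R) :> R.
  by rewrite natr_sum mulr_natl -sumr_const; apply: ler_sum.
have [Y0|[j0 j0Y]] := set_0Vmem Y.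
  move: l; rewrite double_count Y0 big_set0 leNgt.
  by rewrite !mulr_gt0 // ltr0n.
have lt0 : #|[set i in X | r i j0]|%:R < c * #|X|%:R :> R.
  by rewrite ltNge; apply: contra no => le; apply/existsP; exists j0; rewrite j0Y.
have : (\sum_(j in Y) #|[set i in X | r i j]|)%N%:R < #|Y|%:R * (c * #|X|%:R) :> R.
  rewrite natr_sum mulr_natl -sumr_const (bigD1 j0) //= [X in _ < X](bigD1 j0) //=.
  by apply: ltr_leD => //; apply: ler_sum => j /andP[jY _]; apply: lt.
rewrite -double_count => /(le_lt_trans l); apply/negP; rewrite -leNgt.
by rewrite mulrCA [X in _ <= X]mulrCA ler_pM2l // [X in _ <= X]mulrC ler_pM2r // ler_nat.
Qed.

End Counting.

Section Absorbers.
Variables (R : realType) (V : finType) (H : {set {set V}}) (k i : nat) (beta : R).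
Hypothesis kH : kgraph k H.
Hypothesis k3 : (2 < k)%N.
Hypothesis i0 : (0 < i)%N.
Hypothesis beta01 : 0 < beta < 1.
Implicit Types (Z S T U e : {set V}) (X : {set {set V}}).

Let a := (i * k - 1)%N.
Notation pm := (induced_has_perfect_matching H).

(** For each [S] reachability supplies [beta * n^a] sets [T], of which at most
    [(#|Z| + k) * n^(a-1)], hence half of [beta * n^a], meet [Z] or [S]. Averaging over [T] finds
    one that serves a proportion [beta / 2] of [X]. *)
Lemma gadget_step (x : V) Z X (g : {set V} -> V) :
  X != set0 -> (forall S, S \in X -> #|S| = k) ->
  (forall S, S \in X -> reachable k H beta i x (g S)) ->
  2 * (#|Z| + k)%:R <= beta * #|V|%:R ->
  exists T, [/\ #|T| = a, [disjoint T & Z], pm (x |: T) &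
    beta / 2 * #|X|%:R <=
      #|[set S in X | [disjoint T & S] && `[< pm (g S |: T) >]]|%:R].
Proof.
move=> X0 hX hr hZ; have /andP[b0 b1] := beta01.
have a0 : (0 < a)%N by rewrite /a subn_gt0; move: i0 k3; clear; nia.
have n0 : (0 < #|V|)%N.
  rewrite lt0n; apply/eqP=> V0; move: hZ; rewrite V0 mulr0 leNgt.
  by rewrite mulr_gt0 // ltr0n addn_gt0 (ltnW (ltnW k3)) orbT.
pose Y := [set T : {set V} | [&& #|T| == a, [disjoint T & Z] & `[< pm (x |: T) >]]].
have [|||S SX|T] := @averaging R _ _ X Y
    (fun S T : {set V} => [disjoint T & S] && `[< pm (g S |: T) >]) (beta / 2) (#|V| ^ a)%N X0.
- by rewrite divr_gt0.
- by rewrite expn_gt0 n0.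
- apply: leq_trans (card_sets_le _ a); apply: subset_leq_card.
  by apply/subsetP=> T; rewrite !inE => /andP[].
- set c := #|_|; have := hr S SX; rewrite /reachable -/a; set c' := #|_| => hc'.
  have le : (c' <= c + #|Z :|: S| * #|V| ^ a.-1)%N.
    apply: leq_trans (leq_add (leqnn c) (card_sets_meeting_le (Z :|: S) a0)).
    apply: leq_trans (leq_card_setU _ _).1; apply: subset_leq_card.
    apply/subsetP=> T; rewrite inE => /and3P[/eqP cT pmx pmg]; apply/setUP.
    have [d|nd] := boolP [disjoint T & Z :|: S]; [left|right]; last by rewrite inE cT eqxx.
    have dZ : [disjoint T & Z] by apply: disjointWr d; apply: subsetUl.
    have dS : [disjoint T & S] by apply: disjointWr d; apply: subsetUr.
    by rewrite in_set dS pmg andbT in_set cT eqxx dZ pmx.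
  have leZS : (#|Z :|: S| <= #|Z| + k)%N by rewrite -(hX _ SX) (leq_card_setU _ _).1.
  have : 2 * (#|Z :|: S| * #|V| ^ a.-1)%N%:R <= beta * #|V|%:R ^+ a.
    rewrite natrM natrX mulrA -{2}(prednK a0) exprS mulrA; apply: ler_wpM2r; first exact: exprn_ge0.
    by apply: le_trans hZ; apply: ler_wpM2l => //; rewrite ler_nat.
  have hc2 : beta * #|V|%:R ^+ a <= c'%:R := hc'.
  move: le hc2; rewrite -(ler_nat R) natrD natrX.
  by move: (_ ^+ a) (_ * _)%N => p q; clear -b0; lra.
rewrite inE => /and3P[/eqP cT dT /asboolP pmT] hT.
by exists T.
Qed.

(** [gadget_step] is applied to the vertices of [xs] in turn, each time on the surviving subfamily.
    The result [U] is a switch: it is completed to a perfectly matchable set either by [xs] or by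
    its image in any surviving [S]. *)
Lemma gadget_list (xs : seq V) Z X (g : {set V} -> V -> V) :
  uniq xs -> {subset xs <= Z} ->
  X != set0 -> (forall S, S \in X -> #|S| = k) ->
  (forall S x, S \in X -> x \in xs -> reachable k H beta i x (g S x) /\ g S x \in S) ->
  (forall S, S \in X -> {in xs &, injective (g S)}) ->
  2 * (#|Z| + size xs * a + k)%:R <= beta * #|V|%:R ->
  exists U X', [/\ [disjoint U & Z], (#|U| <= size xs * a)%N, pm ([set:: xs] :|: U),
    X' \subset X /\ (beta / 2) ^+ size xs * #|X|%:R <= #|X'|%:R &
    forall S, S \in X' -> [disjoint U & S] /\ pm ([set:: map (g S) xs] :|: U)].
Proof.
have /andP[b0 b1] := beta01.
elim: xs Z X => [|x xs IH] Z X /=.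
  move=> _ _ X0 _ _ _ _; exists set0, X; rewrite cards0 expr0 mul1r.
  have d (A : {set V}) : [disjoint (set0 : {set V}) & A] by apply/disjointP=> y; rewrite inE.
  by split=> // [|S _]; rewrite ?setU0 ?set_nil //; try split=> //; apply: induced_pm0.
case/andP=> xxs uxs sub X0 hX hr hI hZ.
have xZ : x \in Z by apply: sub; rewrite inE eqxx.
have [||T [cT dT pmT leX1]] := @gadget_step x Z X (g^~ x) X0 hX.
- by move=> S SX; case: (hr S x SX); rewrite ?inE ?eqxx.
- by apply: le_trans hZ; rewrite ler_wpM2l // ler_nat; clear; lia.
set X1 := [set S in X | _] in leX1.
have sX1 : X1 \subset X by apply/subsetP=> S; rewrite inE => /andP[].
have X10 : X1 != set0.
  rewrite -card_gt0 -(ltr0n R); apply: lt_le_trans leX1.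
  by rewrite !mulr_gt0 ?invr_gt0 // ltr0n card_gt0.
have [|||||U [X' [dU cU pmU [sX' leX'] hX']]] := IH (Z :|: T) X1 uxs _ X10.
- by move=> y yxs; rewrite inE sub // inE yxs orbT.
- by move=> S /(subsetP sX1)/hX.
- by move=> S y /(subsetP sX1) SX yxs; apply: hr => //; rewrite inE yxs orbT.
- move=> S /(subsetP sX1) SX y z yxs zxs; apply: hI => //; by rewrite inE ?yxs ?zxs orbT.
- apply: le_trans hZ; rewrite ler_wpM2l // ler_nat.
  have := (leq_card_setU Z T).1; rewrite cT; move: #|Z :|: T| #|Z| => p q; clear.
  by rewrite mulSn; lia.
have dUT : [disjoint U & T] by apply: disjointWr dU; apply: subsetUr.
have dUZ : [disjoint U & Z] by apply: disjointWr dU; apply: subsetUl.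
exists (T :|: U), X'; split.
- by apply/disjointP=> y; rewrite inE => /orP[/(disjointFr dT)|/(disjointFr dUZ)] ->.
- by rewrite mulSn -{1}cT; apply: leq_trans (leq_card_setU _ _).1 _; rewrite leq_add2l.
- rewrite set_cons setUACA; apply: induced_pmU => //.
  apply/disjointP=> y; rewrite !inE => /orP[/eqP->|yT].
    by rewrite (negPf xxs) (contraTN _ xZ) // => xU; rewrite (disjointFr dUZ xU).
  rewrite negb_or (contraTN _ yT) => [|yxs].
    by apply: contraTN yT => yU; rewrite (disjointFr dUT yU).
  by apply/negP=> yT'; move: (disjointFr dT yT'); rewrite sub // inE yxs orbT.
- split; first exact: subset_trans sX' sX1.
  apply: le_trans leX'; rewrite exprSr -mulrA ler_wpM2l // exprn_ge0 //.
  by rewrite divr_ge0 // ltW.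
- move=> S SX'; have SX1 := subsetP sX' _ SX'; have [dUS pmg] := hX' _ SX'.
  have [SX dTS pmx] : [/\ S \in X, [disjoint T & S] & pm (g S x |: T)].
    by move: SX1; rewrite inE => /and3P[? ? /asboolP].
  split; first by apply/disjointP=> y; rewrite inE => /orP[/(disjointFr dTS)|/(disjointFr dUS)] ->.
  rewrite set_cons setUACA; apply: induced_pmU => //.
  have gS y : y \in x :: xs -> g S y \in S by move=> yx; case: (hr S y SX yx).
  apply/disjointP=> y; rewrite !inE => /orP[/eqP->|yT].
    rewrite negb_or; apply/andP; split.
      apply/mapP=> -[z zxs e]; move: xxs.
      by rewrite (hI S SX x z _ _ e) ?zxs // inE ?eqxx ?zxs ?orbT.
    apply/negP=> gU; have := disjointFr dUS gU.
    by rewrite gS // inE eqxx.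
  rewrite negb_or; apply/andP; split.
    apply/mapP=> -[z zxs e]; have := disjointFr dTS yT.
    by rewrite e gS // inE zxs orbT.
  by apply/negP=> yU; move: (disjointFr dUT yU); rewrite yT.
Qed.

End Absorbers.

(** * Absorbing layers *)

Section Layers.
Variables (V : finType) (H : {set {set V}}) (k : nat).
Hypothesis kH : kgraph k H.
Hypothesis k3 : (2 < k)%N.
Variables (d : nat) (P : d.-tuple {set V}).
Hypothesis hP : ordered_partition P.
Implicit Types (Z S T U W e G D : {set V}) (X : {set {set V}}) (iv : 'rV[int]_d).

Notation pm := (induced_has_perfect_matching H).
Notation ix := (index_vector P).

Lemma index_vector_set1 x y : (forall j, (x \in tnth P j) = (y \in tnth P j)) ->
  ix [set x] = ix [set y].
Proof.
move=> h; apply/rowP=> j; rewrite !mxE; congr Posz.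
have e z : #|[set z] :&: tnth P j| = (z \in tnth P j).
  case zP: (z \in tnth P j).
    by rewrite (setIidPl _) ?cards1 // sub1set.
  by apply/eqP; rewrite cards_eq0 setI_eq0 disjoints1 zP.
by rewrite !e h.
Qed.

(** Pairs every vertex of [e] with a vertex of [S] in the same part, so that closedness of the parts
    makes each pair reachable. *)
Lemma index_bijection S e : ix S = ix e -> exists f : V -> V,
  {in e &, injective f} /\
  forall x, x \in e -> f x \in S /\ forall j, (x \in tnth P j) = (f x \in tnth P j).
Proof.
have [p hp] := part_function hP.
have [n] := ubnP #|e|; elim: n e S => // n IH e S lee eS.
have [->|[x xe]] := set_0Vmem e.
  by exists id; split=> y; rewrite inE.
have [y yS hy] : exists2 y, y \in S & forall j, (x \in tnth P j) = (y \in tnth P j).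
  have : #|S :&: tnth P (p x)| = #|e :&: tnth P (p x)|.
    by move/rowP: eS => /(_ (p x)); rewrite !mxE => -[].
  rewrite (cardsD1 x (e :&: _)) in_setI xe hp eqxx => h.
  have /card_gt0P[y] : (0 < #|S :&: tnth P (p x)|)%N by rewrite h.
  rewrite in_setI hp => /andP[yS /eqP e1]; exists y => // j.
  by rewrite !hp e1.
have dl z A : [disjoint [set z] & A :\ z] by rewrite disjoints1 setD11.
have [||f [fI fP]] := IH (e :\ x) (S :\ y).
- by move: lee; rewrite (cardsD1 x e) xe.
- move: eS; rewrite -{1}(setD1K yS) -{1}(setD1K xe) !index_vectorU ?dl //.
  by rewrite (index_vector_set1 hy) => /addrI.
exists (fun z => if z == x then y else f z); split=> [z1 z2 h1 h2|z ze].
  case: eqVneq => [->|n1]; case: eqVneq => [->|n2] //.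
  - have [|+ _] := fP z2; first by rewrite !inE n2.
    by rewrite !inE => /andP[/eqP ne _] e1; rewrite -e1 in ne.
  - have [|+ _] := fP z1; first by rewrite !inE n1.
    by rewrite !inE => /andP[/eqP ne _] e1; rewrite e1 in ne.
  - by apply: fI; rewrite !inE ?n1 ?n2.
case: eqVneq => [->|ne] //.
have [|h1 h2] := fP z; first by rewrite !inE ne.
by split=> //; move: h1; rewrite inE => /andP[].
Qed.

(** A layer is spent once: it is left alone, swallows one [k]-set, or gives up one edge, and what
    remains of it is perfectly matchable in all three cases. *)
Definition layer (l : seq 'rV[int]_d) (L : {set V}) : Prop :=
  [/\ pm L,
    (forall iv (S : {set V}), iv \in l -> #|S| = k -> ix S = iv -> [disjoint S & L] -> pm (L :|: S)) &
    (forall iv, iv \in l -> exists e : {set V}, [/\ e \in H, ix e = iv, e \subset L & pm (L :\: e)])].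

Lemma exists_index_subset D iv : (forall j, 0 <= iv 0 j <= ix D 0 j) ->
  exists2 S : {set V}, S \subset D & ix S = iv.
Proof.
move=> h; have [p hp] := part_function hP.
have hj j : exists S : {set V}, S \subset D :&: tnth P j /\ #|S|%:Z = iv 0 j.
  have /andP[h0 h1] := h j; rewrite mxE in h1.
  have [|S sS cS] := @exists_subset_card V (D :&: tnth P j) (absz (iv 0%R j)); first by lia.
  by exists S; split=> //; lia.
have [S hS] := fin_all_exists hj.
have SD j : S j \subset D :&: tnth P j by case: (hS j).
exists (\bigcup_j S j).
  by apply/bigcupsP=> j _; apply: subset_trans (SD j) (subsetIl _ _).
apply/rowP=> j; rewrite mxE; have [_ <-] := hS j; congr Posz; apply: eq_card => x.
rewrite inE; apply/andP/idP=> [[/bigcupP[j' _ xj'] xj]|xj].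
  have := subsetP (SD j') _ xj'; rewrite inE => /andP[_]; move: xj; rewrite !hp.
  by move=> /eqP-> /eqP<-.
split; first by apply/bigcupP; exists j.
by have := subsetP (SD j) _ xj; rewrite inE => /andP[].
Qed.

Lemma bigcup_pm (T : finType) (A : {set T}) (L : T -> {set V}) :
  {in A &, forall j1 j2, j1 != j2 -> [disjoint L j1 & L j2]} ->
  (forall j, j \in A -> pm (L j)) -> pm (\bigcup_(j in A) L j).
Proof.
have [n] := ubnP #|A|; elim: n A => // n IH A leA dA pmA.
have [->|[j jA]] := set_0Vmem A; first by rewrite big_set0; apply: induced_pm0.
rewrite (big_setD1 j) //=; apply: induced_pmU; last 1 first.
- apply: IH; first by move: leA; rewrite (cardsD1 j A) jA.
    by move=> j1 j2; rewrite !inE => /andP[_ ?] /andP[_ ?]; apply: dA.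
  by move=> j1; rewrite !inE => /andP[_ ?]; apply: pmA.
- apply: bigcup_disjoint => j1; rewrite !inE => /andP[ne j1A].
  by apply: dA; rewrite // eq_sym.
- exact: pmA.
Qed.

(* Each listed vector [y] of [ys] is traded for an edge released by one layer,
   after which the enlarged remainder is absorbed piece by piece. *)
Lemma layers_absorb (T : finType) (A : {set T}) (L : T -> {set V})
    (l xs ys : seq 'rV[int]_d) D :
  {in A &, forall j1 j2, j1 != j2 -> [disjoint L j1 & L j2]} ->
  (forall j, j \in A -> layer l (L j) /\ [disjoint D & L j]) ->
  {subset xs <= l} -> {subset ys <= l} -> (forall iv, iv \in l -> rvector k iv) ->
  ix D + \sum_(y <- ys) y = \sum_(x <- xs) x -> (size xs + size ys <= #|A|)%N ->
  pm (D :|: \bigcup_(j in A) L j).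
Proof.
move=> + + sx + hl; elim: ys A D => [|y ys IH] A D dA hA sy.
  rewrite big_nil addr0 addn0; move: sx; elim: xs A D dA hA => [|x xs IH] A D dA hA sx.
    rewrite big_nil => D0 _; have -> : D = set0.
      apply/eqP; rewrite -cards_eq0; have := coord_sum_index D hP; rewrite D0.
      by rewrite /coord_sum big1 => [|j _]; [case: #|D| | rewrite mxE].
    by rewrite set0U; apply: bigcup_pm => // j /hA[[]].
  rewrite big_cons => hD leA.
  have [x0 xk] := hl _ (sx _ (mem_head _ _)).
  (* The remaining vectors are non-negative, so [x] lies coordinatewise below the index vector of
     [D]. *)
  have [|S sSD Sx] := @exists_index_subset D x.
    move=> j; rewrite x0 hD mxE lerDl summxE /=.
    rewrite big_seq; apply: sumr_ge0 => z zxs.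
    by case: (hl z) => // ; apply: sx; rewrite inE zxs orbT.
  have cS : #|S| = k.
    by have := coord_sum_index S hP; rewrite Sx /coord_sum xk => -[].
  have [j jA] : exists j, j \in A by apply/card_gt0P; apply: leq_trans leA.
  have [[pmL absL _] dDL] := hA _ jA.
  have cA : #|A| = #|A :\ j|.+1 by rewrite (cardsD1 j) jA.
  have sA : A :\ j \subset A by apply: subsetDl.
  have eD : D = S :|: (D :\: S) by rewrite setDE setUIr setUCr setIT (setUidPr sSD).
  have dSDS : [disjoint S & D :\: S] by clear; set_solve.
  have hIH : pm ((D :\: S) :|: \bigcup_(j0 in A :\ j) L j0).
    apply: IH.
    - by move=> j1 j2 /(subsetP sA) h1 /(subsetP sA) h2; apply: dA.
    - move=> j1 /(subsetP sA)/hA[? dj]; split=> //.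
      by apply: disjointWl dj; apply: subsetDl.
    - by move=> z zxs; apply: sx; rewrite inE zxs orbT.
    - by move: hD; rewrite {1}eD index_vectorU // Sx => /addrI.
    - by move: leA; rewrite cA.
  have dSL : [disjoint S & L j] by apply: disjointWl dDL.
  have pmLS := absL x S (sx _ (mem_head _ _)) cS Sx dSL.
  have -> : D :|: \bigcup_(j0 in A) L j0 =
      (L j :|: S) :|: ((D :\: S) :|: \bigcup_(j0 in A :\ j) L j0).
    rewrite (big_setD1 j) //= {1}eD; move: (D :\: S) (\bigcup_(_ in _) _) => p q.
    by apply/setP=> z; rewrite !inE; do ![case: (z \in _)].
  apply: induced_pmU => //.
  have dL' : [disjoint L j & \bigcup_(j0 in A :\ j) L j0].
    apply: bigcup_disjoint => j1; rewrite !inE => /andP[ne j1A].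
    by apply: dA; rewrite // eq_sym.
  have dD' : [disjoint D & \bigcup_(j0 in A :\ j) L j0].
    by apply: bigcup_disjoint => j1 /(subsetP sA)/hA[].
  apply/disjointP=> z; rewrite inE => /orP[zL|zS]; rewrite !inE negb_or.
    rewrite (disjointFr dL' zL) andbT; apply/negP=> /andP[_ zD].
    by rewrite (disjointFr dDL zD) in zL.
  by rewrite zS (disjointFr dD' (subsetP sSD _ zS)).
rewrite big_cons => hD leA.
have [j jA] : exists j, j \in A.
  by apply/card_gt0P; apply: leq_trans leA; rewrite /= addnS.
have [[pmL _ relL] dDL] := hA _ jA.
have [e [eH ey seL pme]] := relL y (sy _ (mem_head _ _)).
have cA : #|A| = #|A :\ j|.+1 by rewrite (cardsD1 j) jA.
have sA : A :\ j \subset A by apply: subsetDl.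
have dL1 j1 : j1 \in A :\ j -> [disjoint L j & L j1].
  by rewrite !inE => /andP[ne j1A]; apply: dA; rewrite // eq_sym.
have dDe : [disjoint D & e] by apply: disjointWr dDL.
have hIH : pm ((D :|: e) :|: \bigcup_(j0 in A :\ j) L j0).
  apply: IH.
  - by move=> j1 j2 /(subsetP sA) h1 /(subsetP sA) h2; apply: dA.
  - move=> j1 j1A; have [lj dj] := hA _ (subsetP sA _ j1A); split=> //.
    apply/disjointP=> z; rewrite inE => /orP[/(disjointFr dj)->//|ze].
    by rewrite (disjointFr (dL1 _ j1A)) // (subsetP seL).
  - by move=> z zys; apply: sy; rewrite inE zys orbT.
  - by rewrite index_vectorU // ey -addrA.
  - by move: leA; rewrite cA /= addnS.
have -> : D :|: \bigcup_(j0 in A) L j0 =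
    ((D :|: e) :|: \bigcup_(j0 in A :\ j) L j0) :|: (L j :\: e).
  have eL : L j = e :|: (L j :\: e) by rewrite setDE setUIr setUCr setIT (setUidPr seL).
  rewrite (big_setD1 j) //= {1}eL; move: (L j :\: e) (\bigcup_(_ in _) _) => p q.
  by apply/setP=> z; rewrite !inE; do ![case: (z \in _)].
apply: induced_pmU => //.
apply/disjointP=> z; rewrite !inE -orbA => /or3P[zD|->//|zL].
  by rewrite (disjointFr dDL zD) andbF.
case/bigcupP: zL => j1 j1A zj1; apply/negP=> /andP[_ zj].
by rewrite (disjointFr (dL1 _ j1A) zj) in zj1.
Qed.

Definition unabsorbed iv G : {set {set V}} :=
  [set S : {set V} | [&& #|S| == k, ix S == iv, [disjoint S & G] & ~~ `[< pm (G :|: S) >]]].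

Definition available iv b := forall W : {set V}, (#|W| <= b)%N ->
  exists e : {set V}, [/\ e \in H, ix e = iv & [disjoint e & W]].

Variables (R : realType) (i : nat) (beta : R).
Hypothesis i0 : (0 < i)%N.
Hypothesis beta01 : 0 < beta < 1.
Hypothesis hclosed : forall j : 'I_d, closed_in k H beta i (tnth P j).

Let a := (i * k - 1)%N.
(** A gadget consists of an edge and one set of [a] vertices for each of its vertices; [c] below
    collects one factor [beta / 2] per vertex. *)
Let gs := (k + k * a)%N.
Let c : R := (beta / 2) ^+ k.

(** The gadget is [e :|: U] with [U] the switch of [gadget_list]. Alone, [U] is matched together
    with [e]; when [S] is absorbed, [U] is matched with [S] and [e] serves as an edge. *)
Lemma gadget_exists iv e Z X : e \in H -> ix e = iv -> [disjoint e & Z] ->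
  X != set0 -> (forall S, S \in X -> [/\ #|S| = k, ix S = iv & [disjoint S & e]]) ->
  2 * (#|Z| + gs + k)%:R <= beta * #|V|%:R ->
  exists G X', [/\ [disjoint G & Z], (#|G| <= gs)%N, pm G & e \subset G] /\
    [/\ X' \subset X, c * #|X|%:R <= #|X'|%:R &
    forall S, S \in X' -> [disjoint S & G] /\ pm (G :|: S)].
Proof.
move=> eH eiv deZ X0 hX hZ.
have hf S : exists f : V -> V, S \in X -> {in e &, injective f} /\
    forall x, x \in e -> f x \in S /\ forall j, (x \in tnth P j) = (f x \in tnth P j).
  have [/hX[_ Siv _]|] := boolP (S \in X); last by exists id.
  by have [|f hf] := @index_bijection S e; [rewrite Siv | exists f].
have [f {}hf] := fin_all_exists hf.
have size_e : size (enum e) = k by rewrite -cardE (kH eH).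
have [p hp] := part_function hP.
have [|||||||U [X' [dU cU pmU [sX' leX'] hX']]] :=
  @gadget_list R V H k i beta k3 i0 beta01 (enum e) (Z :|: e) X f.
- exact: enum_uniq.
- by move=> x; rewrite mem_enum inE orbC => ->.
- exact: X0.
- by move=> S /hX[].
- move=> S x SX; rewrite mem_enum => xe; have [_ /(_ x xe)[fS fj]] := hf S SX.
  split=> //; apply: (hclosed (j := p x)); rewrite -?fj ?hp //.
  apply: contraTneq xe => ->; have [_ _ d1] := hX S SX.
  by rewrite (disjointFr d1 fS).
- by move=> S SX x y; rewrite !mem_enum; case: (hf S SX) => fI _; apply: fI.
- rewrite size_e; apply: le_trans hZ; rewrite ler_wpM2l // ler_nat.
  have := (leq_card_setU Z e).1; rewrite (kH eH) /gs -/a; move: (k * a)%N => ka; clear; lia.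
rewrite size_e -/a in cU; rewrite size_e -/c in leX'.
have dUe : [disjoint U & e] by apply: disjointWr dU; apply: subsetUr.
have dUZ : [disjoint U & Z] by apply: disjointWr dU; apply: subsetUl.
have ee : [set:: enum e] = e by apply/setP=> x; rewrite inE mem_enum.
exists (e :|: U), X'; split; split=> //.
- by apply/disjointP=> x; rewrite inE => /orP[/(disjointFr deZ)|/(disjointFr dUZ)] ->.
- by apply: leq_trans (leq_card_setU _ _).1 _; rewrite (kH eH) /gs leq_add2l.
- by rewrite -ee.
- exact: subsetUl.
move=> S SX'; have SX := subsetP sX' _ SX'; have [dUS pmS] := hX' S SX'.
have [cS Siv dSe] := hX S SX; have [fI fS] := hf S SX.
have eS : [set:: map (f S) (enum e)] = S.
  apply/eqP; rewrite eqEcard cS cardsE (card_uniqP _) ?size_map ?size_e ?leqnn ?andbT.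
    by apply/subsetP=> y; rewrite inE => /mapP[x + ->]; rewrite mem_enum => /fS[].
  by rewrite map_inj_in_uniq ?enum_uniq // => x y; rewrite !mem_enum; apply: fI.
rewrite eS in pmS; split.
  apply/disjointP=> x xS; rewrite inE (disjointFr dSe xS) /=.
  by apply/negP=> xU; rewrite (disjointFr dUS xU) in xS.
rewrite -setUA [U :|: S]setUC; apply: induced_pmU => //; last exact: induced_pm1.
apply/disjointP=> x xe; rewrite inE negb_or.
apply/andP; split; apply/negP=> h; move: xe.
  by rewrite (disjointFr dSe h).
by rewrite (disjointFr dUe h).
Qed.

(** Every new gadget handles a proportion [c] of the sets still unabsorbed and disjoint from its
    edge. Sets that meet the gadget need no treatment, since [unabsorbed] only counts sets disjoint
    from the absorber. *)
Lemma absorber iv Z b r : available iv b ->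
  (#|Z| + r * gs <= b)%N -> 2 * (b + gs + k)%:R <= beta * #|V|%:R ->
  exists G, [/\ [disjoint G & Z], (#|G| <= r * gs)%N, pm G &
    #|unabsorbed iv G|%:R <= (1 - c) ^+ r * #|V|%:R ^+ k].
Proof.
move=> hav leb hb; have /andP[b0 b1] := beta01.
have c01 : 0 <= c <= 1.
  by rewrite exprn_ge0 ?exprn_ile1 ?divr_ge0 //; lra.
elim: r leb => [|r IH] leb.
  exists set0; rewrite cards0; split=> //; [by apply/disjointP=> x; rewrite inE | exact: induced_pm0 |].
  rewrite expr0 mul1r -natrX ler_nat; apply: leq_trans (card_sets_le V k).
  by apply: subset_leq_card; apply/subsetP=> S; rewrite !inE => /andP[].
have [|G [dG cG pmG hG]] := IH; first by apply: leq_trans leb; rewrite leq_add2l leq_mul2r leqnSn orbT.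
have cZG : (#|Z :|: G| <= b)%N.
  apply: leq_trans (leq_card_setU _ _).1 (leq_trans _ leb).
  by rewrite leq_add2l (leq_trans cG) // leq_mul2r leqnSn orbT.
have pow0 : 0 <= (1 - c) ^+ r * #|V|%:R ^+ k.
  by rewrite mulr_ge0 ?exprn_ge0 // subr_ge0; case/andP: c01.
have [e [eH eiv deZG]] := hav _ cZG.
have deZ : [disjoint e & Z] by apply: disjointWr deZG; apply: subsetUl.
have deG : [disjoint e & G] by apply: disjointWr deZG; apply: subsetUr.
have legs : (k <= gs)%N by apply: leq_addr.
set X := unabsorbed iv G in hG.
pose X0 := [set S in X | [disjoint S & e]].
have step G1 : [disjoint G1 & Z :|: G] -> (#|G1| <= gs)%N -> pm G1 -> e \subset G1 ->
    #|unabsorbed iv (G :|: G1)|%:R <= (1 - c) ^+ r.+1 * #|V|%:R ^+ k ->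
    exists G, [/\ [disjoint G & Z], (#|G| <= r.+1 * gs)%N, pm G &
      #|unabsorbed iv G|%:R <= (1 - c) ^+ r.+1 * #|V|%:R ^+ k].
  move=> d1 c1 pm1 _ le.
  have d1G : [disjoint G1 & G] by apply: disjointWr d1; apply: subsetUr.
  have d1Z : [disjoint G1 & Z] by apply: disjointWr d1; apply: subsetUl.
  exists (G :|: G1); split=> //.
  - by apply/disjointP=> x; rewrite inE => /orP[/(disjointFr dG)|/(disjointFr d1Z)] ->.
  - by rewrite mulSn addnC; apply: leq_trans (leq_card_setU _ _).1 (leq_add cG c1).
  - by apply: induced_pmU; rewrite // disjoint_sym.
have sub G1 : [disjoint G1 & Z :|: G] -> pm G1 -> e \subset G1 ->
    forall S, S \in unabsorbed iv (G :|: G1) ->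
      [/\ S \in X0, [disjoint S & G1] & ~ pm (G1 :|: S)].
  move=> d1 pm1 se S; rewrite inE => /and4P[cS Siv dS /asboolP nS].
  have d1G : [disjoint G1 & G] by apply: disjointWr d1; apply: subsetUr.
  have dSG : [disjoint S & G] by apply: disjointWr dS; apply: subsetUl.
  have dSG1 : [disjoint S & G1] by apply: disjointWr dS; apply: subsetUr.
  have dSe : [disjoint S & e] by apply: disjointWr dSG1.
  split=> //.
    rewrite inE dSe andbT inE cS Siv dSG /=; apply/asboolP=> pmS; apply: nS.
    rewrite setUAC; apply: induced_pmU => //.
    apply/disjointP=> x; rewrite inE => /orP[xG|xS]; last by rewrite (disjointFr dSG1 xS).
    by apply/negP=> x1; rewrite (disjointFr d1G x1) in xG.
  move=> pmS; apply: nS; rewrite -setUA; apply: induced_pmU => //.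
  apply/disjointP=> x xG; rewrite inE negb_or; apply/andP; split; apply/negP=> h.
    by rewrite (disjointFr d1G h) in xG.
  by rewrite (disjointFr dSG h) in xG.
have [X00|X0n] := eqVneq X0 set0.
  apply: (step e); rewrite ?(kH eH) //; first exact: induced_pm1.
  rewrite (_ : unabsorbed _ _ = set0).
    by rewrite cards0 mulr_ge0 ?exprn_ge0 // subr_ge0; case/andP: c01.
  apply/eqP; rewrite -subset0; apply/subsetP=> S SX.
  by have [] := sub e deZG (induced_pm1 eH) (subxx _) S SX; rewrite X00.
have [||G1 [X' [[d1 c1 pm1 se] [sX' leX' hX']]]] :=
  @gadget_exists iv e (Z :|: G) X0 eH eiv deZG X0n.
- move=> S; rewrite inE => /andP[+ dSe]; rewrite inE.
  by case/and4P=> /eqP ? /eqP ? _ _.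
- apply: le_trans hb; rewrite ler_wpM2l // ler_nat !leq_add2r //.
apply: (step G1) => //.
have sD : unabsorbed iv (G :|: G1) \subset X0 :\: X'.
  apply/subsetP=> S /(sub G1 d1 pm1 se)[SX0 dS nS]; rewrite in_setD SX0 andbT.
  by apply/negP=> /hX'[_ /nS].
have le1 : #|unabsorbed iv (G :|: G1)|%:R <= #|X0|%:R - #|X'|%:R :> R.
  rewrite -natrB ?subset_leq_card // ler_nat; apply: leq_trans (subset_leq_card sD) _.
  by rewrite cardsD (setIidPr sX').
have le2 : #|X0|%:R <= #|X|%:R :> R.
  by rewrite ler_nat subset_leq_card //; apply/subsetP=> S; rewrite inE => /andP[].
apply: le_trans le1 _; apply: le_trans (_ : (1 - c) * #|X0|%:R <= _).
  by rewrite mulrBl mul1r lerB.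
rewrite exprS -mulrA ler_wpM2l //; last exact: le_trans le2 hG.
by rewrite subr_ge0; case/andP: c01.
Qed.

(** For each vector of [l] the layer receives a separate edge, to be released if necessary, and an
    absorber with [r] gadgets. The number of sets it leaves unabsorbed is an integer below 1, hence
    0. *)
Lemma layer_exists (l : seq 'rV[int]_d) Z b r :
  (forall iv, iv \in l -> available iv b) ->
  (#|Z| + size l * (r * gs + k) <= b)%N -> 2 * (b + gs + k)%:R <= beta * #|V|%:R ->
  (1 - c) ^+ r * #|V|%:R ^+ k < 1 ->
  exists L : {set V}, [/\ [disjoint L & Z], (#|L| <= size l * (r * gs + k))%N & layer l L].
Proof.
move=> + + hb hr; elim: l Z => [|iv l IH] Z hav lez.
  exists set0; rewrite cards0; split=> //; first by apply/disjointP=> x; rewrite inE.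
  by split=> //; apply: induced_pm0.
rewrite [size _]/= mulSn in lez *.
have [|e [eH eiv deZ]] := hav iv (mem_head _ _) Z; first by apply: leq_trans lez; apply: leq_addr.
have cZe : (#|Z :|: e| <= #|Z| + k)%N by rewrite -(kH eH) (leq_card_setU _ _).1.
have [|G [dG cG pmG hG]] := @absorber iv (Z :|: e) b r (hav _ (mem_head _ _)) _ hb.
  by move: cZe lez; move: #|Z :|: e| #|Z| (r * gs)%N (size l * _)%N => p q u v; clear; lia.
have {hG} G0 : unabsorbed iv G = set0.
  apply/eqP; rewrite -cards_eq0 -leqn0 -ltnS -(ltr_nat R).
  exact: le_lt_trans hG hr.
have [||L [dL cL [pmL absL relL]]] := IH (Z :|: e :|: G).
- by move=> iv' h; apply: hav; rewrite inE h orbT.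
- have := (leq_card_setU (Z :|: e) G).1.
  move: cZe cG lez; move: #|Z :|: e| #|Z :|: e :|: G| #|G| #|Z| (r * gs)%N (size l * _)%N.
  by clear; lia.
have dGe : [disjoint G & e] by apply: disjointWr dG; apply: subsetUr.
have dGZ : [disjoint G & Z] by apply: disjointWr dG; apply: subsetUl.
have dLG : [disjoint L & G] by apply: disjointWr dL; apply: subsetUr.
have dLe : [disjoint L & e].
  by apply: disjointWr dL; rewrite -setUA setUCA; apply: subsetUl.
have dLZ : [disjoint L & Z].
  by apply: disjointWr dL; rewrite -setUA; apply: subsetUl.
have pme := induced_pm1 eH.
exists (e :|: G :|: L); split.
- apply/disjointP=> x; rewrite !inE -orbA.
  by case/or3P=> [/(disjointFr deZ)|/(disjointFr dGZ)|/(disjointFr dLZ)] ->.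
- apply: leq_trans (leq_card_setU _ _).1 _; apply: leq_add cL.
  by apply: leq_trans (leq_card_setU _ _).1 _; rewrite addnC (kH eH) leq_add2r.
have deG : [disjoint e & G] by rewrite disjoint_sym.
have deL : [disjoint e & L] by rewrite disjoint_sym.
have dGL : [disjoint G & L] by rewrite disjoint_sym.
have pmeG : pm (e :|: G) by apply: induced_pmU.
have deGL : [disjoint e :|: G & L].
  by apply/disjointP=> x; rewrite inE => /orP[/(disjointFr deL)|/(disjointFr dGL)] ->.
split.
- exact: induced_pmU.
- move=> iv' S; rewrite inE => /orP[/eqP->|il] cS Siv dS.
    have dSG : [disjoint S & G].
      by apply: disjointWr dS; rewrite -setUA setUCA; apply: subsetUl.
    have dSe : [disjoint S & e].
      by apply: disjointWr dS; rewrite -setUA; apply: subsetUl.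
    have dSL : [disjoint S & L] by apply: disjointWr dS; apply: subsetUr.
    have pmGS : pm (G :|: S).
      have : S \notin unabsorbed iv G by rewrite G0 inE.
      by rewrite inE cS Siv !eqxx dSG /= negbK => /asboolP.
    have -> : e :|: G :|: L :|: S = (e :|: L) :|: (G :|: S).
      by apply/setP=> x; rewrite !inE; do ![case: (x \in _)].
    apply: induced_pmU => //; last exact: induced_pmU.
    apply/disjointP=> x; rewrite !inE => /orP[xe|xL].
      rewrite (disjointFr deG xe) /=; apply/negP=> xS.
      by rewrite (disjointFr dSe xS) in xe.
    rewrite (disjointFr dLG xL) /=; apply/negP=> xS.
    by rewrite (disjointFr dSL xS) in xL.
  have dSL : [disjoint S & L] by apply: disjointWr dS; apply: subsetUr.
  have dSeG : [disjoint S & e :|: G] by apply: disjointWr dS; apply: subsetUl.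
  rewrite -setUA; apply: induced_pmU => //; last exact: (absL iv').
  apply/disjointP=> x xeG; rewrite inE (disjointFr deGL xeG) /=.
  by apply/negP=> xS; rewrite (disjointFr dSeG xS) in xeG.
- move=> iv'; rewrite inE => /orP[/eqP->|il].
    exists e; split=> //; first by rewrite -setUA subsetUl.
    rewrite (_ : _ :\: e = G :|: L); first exact: induced_pmU.
    apply/setP=> x; rewrite !inE; case xe: (x \in e) => //=.
    by rewrite (disjointFr deG xe) (disjointFr deL xe).
  have [f [fH fiv sfL pmf]] := relL iv' il; exists f; split=> //.
    by apply: subset_trans sfL (subsetUr _ _).
  rewrite (_ : _ :\: f = (e :|: G) :|: (L :\: f)).
    by apply: induced_pmU => //; apply: disjointWr deGL; apply: subsetDl.
  apply/setP=> x; rewrite !inE; case xf: (x \in f) => //=; rewrite orbF.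
  by have := disjointFr dLe (subsetP sfL _ xf); have := disjointFr dLG (subsetP sfL _ xf) => -> ->.
Qed.

Lemma layers_exist (l : seq 'rV[int]_d) Z b r (n : nat) :
  (forall iv, iv \in l -> available iv b) ->
  (#|Z| + n * (size l * (r * gs + k)) <= b)%N -> 2 * (b + gs + k)%:R <= beta * #|V|%:R ->
  (1 - c) ^+ r * #|V|%:R ^+ k < 1 ->
  exists L : nat -> {set V}, [/\ forall j, (j < n)%N -> layer l (L j) /\ [disjoint L j & Z],
    (forall j1 j2, (j1 < j2 < n)%N -> [disjoint L j1 & L j2]) &
    (#|\bigcup_(j < n) L j| <= n * (size l * (r * gs + k)))%N].
Proof.
move=> hav + hb hr; elim: n => [|n IH] le.
  exists (fun=> set0); rewrite big_ord0 cards0; split=> // j1 j2.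
  by rewrite ltn0 andbF.
rewrite mulSn in le *.
have [|L [hL dL cL]] := IH; first by move: le; clear; lia.
have [|L' [dL' cL' lL']] := @layer_exists l (Z :|: \bigcup_(j < n) L j) b r hav _ hb hr.
  apply: leq_trans le; rewrite [X in (_ <= _ + X)%N]addnC addnA leq_add2r.
  by apply: leq_trans (leq_card_setU _ _).1 _; rewrite leq_add2l.
have dL'Z : [disjoint L' & Z] by apply: disjointWr dL'; apply: subsetUl.
have dL'L j : (j < n)%N -> [disjoint L' & L j].
  move=> jn; apply: disjointWr dL'; apply: subset_trans (subsetUr _ _).
  exact: (bigcup_sup (Ordinal jn)).
exists (fun j => if (j < n)%N then L j else L'); split.
- by move=> j _; case: ifP => [/hL|_].
- move=> j1 j2 /andP[lt ltn2].
  have lt1 : (j1 < n)%N by apply: leq_trans lt _.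
  rewrite lt1; case: ifP => lt2; first by apply: dL; rewrite lt lt2.
  by rewrite disjoint_sym dL'L.
- rewrite big_ord_recr /= ltnn addnC; apply: leq_trans (leq_card_setU _ _).1 _.
  rewrite leq_add // (eq_bigr (fun j : 'I_n => L j)) // => j _.
  by rewrite ltn_ord.
Qed.

End Layers.

(** * The two implications *)

Lemma bernoulli (R : realFieldType) (x : R) n : 0 <= x -> 1 + x *+ n <= (1 + x) ^+ n.
Proof.
move=> x0; elim: n => [|n IH]; first by rewrite mulr0n addr0 expr0.
rewrite exprS; apply: le_trans (_ : (1 + x) * (1 + x *+ n) <= _); last first.
  by rewrite ler_wpM2l // addr_ge0.
rewrite mulrDl mul1r mulrDr mulr1 mulrS.
have : 0 <= x * x *+ n by rewrite mulrn_wge0 // mulr_ge0.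
by rewrite mulrnAr; move: (x *+ n) (_ *+ n) => p q h; lra.
Qed.

(** With [j = n %/ Q] and [x = q^-1 - 1], Bernoulli gives [q^j * j * x < 1]. Of the [k + 1] factors
    [q^j], [k] absorb [n^k <= (2 * Q * j)^k] up to a constant, and the last one beats that constant,
    collected in [t]. *)
Lemma exp_beats_power (R : realType) (q : R) (Q k : nat) : 0 < q < 1 -> (0 < Q)%N ->
  exists n0, forall n, (n0 <= n)%N -> q ^+ (k.+1 * (n %/ Q)) * n%:R ^+ k < 1.
Proof.
move=> /andP[q0 q1] Q0; pose x := q^-1 - 1.
have x0 : 0 < x by rewrite subr_gt0 invf_gt1.
have qj j : (0 < j)%N -> q ^+ j * j%:R * x < 1.
  move=> j0; rewrite -mulrA mulr_natl mulrC -ltr_pdivlMr ?exprn_gt0 // mul1r -exprVn.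
  have -> : q^-1 = 1 + x by rewrite /x addrC subrK.
  by apply: lt_le_trans (bernoulli j (ltW x0)); rewrite ltrDr.
pose t := ((2 * Q)%:R / x) ^+ k / x.
have t0 : 0 <= t by rewrite !mulr_ge0 ?exprn_ge0 ?mulr_ge0 ?invr_ge0 ?ler0n // ltW.
exists (Q * (Num.bound t).+1)%N => n ln.
set j := (n %/ Q)%N.
have lj : (Num.bound t < j)%N by rewrite /j leq_divRL // mulnC.
have j0 : (0 < j)%N by apply: leq_trans lj.
have ln2 : (n <= 2 * Q * j)%N.
  have := divn_eq n Q; have := ltn_pmod n Q0; rewrite -/j; move: j0; clear.
  by move: (n %% Q)%N => p; nia.
have tj : t < j%:R.
  by apply: lt_trans (archi_boundP t0) _; rewrite ltr_nat.
have hq := qj j j0; have qj0 : 0 < q ^+ j by apply: exprn_gt0.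
have jR : 0 < j%:R :> R by rewrite ltr0n.
rewrite mulnC exprM; set u := q ^+ j in hq qj0 *.
apply: (@le_lt_trans _ _ (u ^+ k.+1 * (2 * Q * j)%:R ^+ k)).
  by rewrite ler_pM2l ?exprn_gt0 // lerXn2r ?nnegrE ?ler0n // ler_nat.
have -> : u ^+ k.+1 * (2 * Q * j)%:R ^+ k = u * x * (u * j%:R * x) ^+ k * t.
  have xk : x ^+ k != 0 by rewrite expf_neq0 // gt_eqF.
  have xn : x != 0 by rewrite gt_eqF.
  rewrite /t exprS (natrM _ (2 * Q)) !exprMn exprVn; field.
  by rewrite xn xk.
apply: (@le_lt_trans _ _ (u * x * t)).
  apply: ler_wpM2r => //; rewrite -[X in _ <= X]mulr1; apply: ler_wpM2l.
    by rewrite mulr_ge0 // ltW.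
  by apply: exprn_ile1; [rewrite !mulr_ge0 // ltW | exact: ltW].
rewrite mulrAC; apply: (@lt_trans _ _ (u * j%:R * x)) hq.
by rewrite ltr_pM2r // ltr_pM2l.
Qed.

(** * Robust index vectors: a finite list and disjoint edges *)

Section Transfer.
Variables (R : realType) (V : finType) (H : {set {set V}}) (k d : nat) (mu : R).
Variable P : d.-tuple {set V}.
Hypothesis kH : kgraph k H.
Hypothesis mu0 : 0 < mu.
Hypothesis V0 : (0 < #|V|)%N.
Hypothesis hP : ordered_partition P.

Lemma index_vector_rvector (e : {set V}) : #|e| = k -> rvector k (index_vector P e).
Proof.
move=> ce; split=> [j|]; first by rewrite mxE.
by have := coord_sum_index e hP; rewrite ce.
Qed.

Lemma robust_edge v : robust_index_vectors k mu P H v ->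
  exists2 e, e \in H & index_vector P e = v.
Proof.
rewrite /robust_index_vectors => h.
have : (0 < #|[set e in H | index_vector P e == v]|)%N.
  rewrite -(ltr0n R); apply: lt_le_trans h.
  by rewrite mulr_gt0 // exprn_gt0 // ltr0n.
by case/card_gt0P=> e; rewrite inE => /andP[eH /eqP <-]; exists e.
Qed.

Lemma robust_rvector v : robust_index_vectors k mu P H v -> rvector k v.
Proof. by case/robust_edge=> e /kH ce <-; apply: index_vector_rvector. Qed.

Lemma robust_list : exists l : seq 'rV[int]_d, (size l <= k.+1 ^ d)%N /\
  forall v, v \in l <-> robust_index_vectors k mu P H v.
Proof.
pose enc (f : {ffun 'I_d -> 'I_k.+1}) : 'rV[int]_d := \row_j (f j : nat)%:Z.
exists [seq v <- [seq enc f | f <- enum {ffun 'I_d -> 'I_k.+1}] |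
  `[< robust_index_vectors k mu P H v >]]; split.
  rewrite size_filter; apply: leq_trans (count_size _ _) _.
  by rewrite size_map -cardT card_ffun !card_ord.
move=> v; rewrite mem_filter; split=> [/andP[/asboolP]//|rv]; apply/andP; split.
  exact/asboolP.
have [e eH <-] := robust_edge rv.
have lt j : (#|e :&: tnth P j| < k.+1)%N by rewrite ltnS -(kH eH) subset_leq_card ?subsetIl.
apply/mapP; exists [ffun j => Ordinal (lt j)]; first by rewrite mem_enum.
by apply/rowP=> j; rewrite !mxE ffunE.
Qed.

(** At most [b * n^(k-1)] edges meet a set of [b] vertices, fewer than the [mu * n^k] edges with
    index vector [v]. *)
Lemma robust_available v b : (0 < k)%N -> robust_index_vectors k mu P H v ->
  b%:R < mu * #|V|%:R -> available H P v b.
Proof.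
move=> k0 rv hb W leW.
have [/existsP[e /and3P[eH /eqP ev dW]]|no] :=
  boolP [exists e, [&& e \in H, index_vector P e == v & [disjoint e & W]]].
  by exists e.
exfalso; move: rv; rewrite /robust_index_vectors; set c := #|_| => rv.
have : (c <= b * #|V| ^ k.-1)%N.
  apply: leq_trans (leq_mul leW (leqnn _)).
  apply: leq_trans (card_sets_meeting_le W k0); apply: subset_leq_card.
  apply/subsetP=> e; rewrite !inE => /andP[eH ev]; rewrite (kH eH) eqxx /=.
  by apply: contra no => dW; apply/existsP; exists e; rewrite eH ev.
rewrite -(ler_nat R) natrM natrX => /(le_trans rv).
rewrite -{1}(prednK k0) exprS mulrA ler_pM2r ?exprn_gt0 ?ltr0n //.
by rewrite leNgt hb.
Qed.

End Transfer.

Lemma index_vector_bigcup (V T : finType) d (P : d.-tuple {set V}) (A : {set T})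
    (L : T -> {set V}) :
  (forall j1 j2, j1 != j2 -> [disjoint L j1 & L j2]) ->
  index_vector P (\bigcup_(j in A) L j) = \sum_(j in A) index_vector P (L j).
Proof.
move=> dL; have [n] := ubnP #|A|; elim: n A => // n IH A leA.
have [->|[j jA]] := set_0Vmem A; first by rewrite !big_set0 index_vector0.
rewrite !(big_setD1 j jA) /= index_vectorU ?IH //.
  by move: leA; rewrite (cardsD1 j A) jA.
by apply: bigcup_disjoint => j1; rewrite !inE => /andP[ne _]; apply: dL; rewrite eq_sym.
Qed.

(** * Perfect matchings and solubility *)

Section Final.
Variables (R : realType) (V : finType) (H : {set {set V}}) (k : nat).
Hypothesis kH : kgraph k H.
Hypothesis k3 : (2 < k)%N.
Hypothesis V0 : (0 < #|V|)%N.
Notation pm := (induced_has_perfect_matching H).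

Lemma zero_sum_matching d (P : d.-tuple {set V}) L (M : {set {set V}}) :
  ordered_partition P -> is_lattice L -> full_lattice k L ->
  M \subset H ->
  exists B : {set {set V}}, [/\ B \subset M, (#|B| < d)%N &
    L (\sum_(e in M :\: B) index_vector P e)].
Proof.
move=> hP lL fL sM; have [p _] := part_function hP.
have d0 : (0 < d)%N by case/card_gt0P: V0 => v _; case: (p v) => j; apply: leq_ltn_trans.
apply: (zero_sum_subset lL fL k3 d0) => e /(subsetP sM)/kH ce; exists 1.
by rewrite coord_sum_index // ce mulr1.
Qed.

Lemma perfect_matching_soluble d (P : d.-tuple {set V}) L :
  ordered_partition P -> is_lattice L -> full_lattice k L ->
  has_perfect_matching H -> soluble H P L.
Proof.
move=> hP lL fL [M [[sM tM] cM]].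
have [B [sB cB LB]] := zero_sum_matching hP lL fL sM.
have tB : finset.trivIset B by apply: trivIsetS tM.
exists B; split=> //; first by split=> //; apply: subset_trans sM.
have -> : ~: finset.cover B = finset.cover (M :\: B).
  by rewrite cover_setD // cM setTD.
by rewrite index_vector_cover //; apply: trivIsetS (subsetDl _ _) tM.
Qed.

Lemma perfect_matching_parity : has_perfect_matching H -> ~ parity_family k H.
Proof.
move=> [M [[sM tM] cM]] [_ _ [X [oX hX]]].
have k0 : (0 < k)%N by apply: ltnW (ltnW k3).
have cV : #|V| = (#|M| * k)%N.
  by rewrite -cardsT -cM (matching_card kH sM tM).
have cX : #|X| = (\sum_(e in M) #|e :&: X|)%N.
  by rewrite -card_coverI // cM setTI.
have oM : odd #|X| = odd #|M|.
  rewrite cX -sum1_card !(big_morph odd oddD (erefl _)).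
  by apply: eq_bigr => e /(subsetP sM)/hX ->.
move: oX; rewrite cV mulnK //; move: oM; move: #|X| #|M| => x y; clear; lia.
Qed.

Lemma soluble_perfect_matching (i : nat) (beta mu : R) (m b r N : nat)
    d d' (P : d.-tuple {set V}) (P' : d'.-tuple {set V}) :
  (0 < i)%N -> 0 < beta < 1 -> 0 < mu -> #|V| = (k * m)%N ->
  (forall S : {set V}, #|S| = k.-1 -> (m <= #|nbr H S|)%N) ->
  ordered_partition P -> ordered_partition P' -> (d <= k)%N -> (d' <= k)%N ->
  full_lattice k (robust_lattice k mu P' H) ->
  (forall D : {set V}, robust_lattice k mu P' H (index_vector P' D) ->
     robust_lattice k mu P H (index_vector P D)) ->
  (forall j : 'I_d, closed_in k H beta i (tnth P j)) ->
  (forall I : 'rV[int]_d -> Prop, (forall v, I v -> rvector k v) ->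
    forall v : 'rV[int]_d, (forall j, 0 <= v 0 j <= (2 * (k * k) * k.-1 + k * k)%N%:Z) ->
    lattice_generated I v -> bounded_lists I N v) ->
  (k * k + (2 * N + k) * (k.+1 ^ k * (r * (k + k * (i * k - 1)) + k)) <= b)%N ->
  2 * (b + (k + k * (i * k - 1)) + k)%:R <= beta * #|V|%:R ->
  b%:R < mu * #|V|%:R ->
  (1 - (beta / 2) ^+ k) ^+ r * #|V|%:R ^+ k < 1 ->
  (20 * (k * k) * (2 * k * b).+1 <= m)%N ->
  soluble H P' (robust_lattice k mu P' H) -> ~ parity_family k H ->
  has_perfect_matching H.
Proof.
move=> i0 beta01 mu0 cV hdeg hP hP' dk d'k fL hiii hcl hN leb hb hmu hr lem [M1 [[sM1 tM1] cM1 LM1]] hpar.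
set L' := robust_lattice k mu P' H in fL LM1 hiii.
have lL' : is_lattice L' by apply: lattice_generated_is_lattice.
have k0 : (0 < k)%N by apply: ltnW (ltnW k3).
(* The threshold is the one in [near_perfect_matching] for [#|W| = b]; when it fails,
   [extremal_perfect_matching] applies with [s = 2 * k * b]. *)
have [nonext|ext] := pselect (forall B : {set V}, (#|~: B| <= m + 2 * k * b)%N ->
    exists2 e, e \in H & e \subset B); last first.
  have [B [cB hB]] : exists B : {set V}, (#|~: B| <= m + 2 * k * b)%N /\
      forall e, e \in H -> ~~ (e \subset B).
    apply: contrapT => no; apply: ext => B cB; apply: contrapT => no'; apply: no.
    by exists B; split=> // e eH; apply/negP=> eB; apply: no'; exists e.
  exact: (extremal_perfect_matching kH k3 cV hdeg hB cB lem hpar).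
set Z := finset.cover M1.
have cZ : (#|Z| <= k * k)%N.
  rewrite (matching_card kH sM1 tM1) leq_mul2r; apply/orP; right.
  exact: leq_trans (ltnW cM1) d'k.
have [l [sl hl]] := robust_list P kH mu0 V0.
have sl' : (size l <= k.+1 ^ k)%N by apply: leq_trans sl _; rewrite leq_pexp2l.
set gs := (k + k * (i * k - 1))%N in leb hb.
(* [N] layers to absorb, [N] to release edges, and up to [k] that the zero-sum selection
   discards. *)
set C := (2 * N + k)%N in leb.
have leC : (C * (size l * (r * gs + k)) <= C * (k.+1 ^ k * (r * gs + k)))%N.
  by rewrite leq_mul2l leq_mul2r sl' !orbT.
have [||||L [hL dL cL]] := @layers_exist V H k kH k3 d P hP R i beta i0 beta01 hcl l Z b r C.
- by move=> iv /hl rv; apply: (@robust_available R V H k d mu P _ _ iv b k0 rv hmu).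
- by apply: leq_trans leb; apply: leq_add.
- exact: hb.
- exact: hr.
have dLj (j1 j2 : 'I_C) : j1 != j2 -> [disjoint L j1 & L j2].
  rewrite -val_eqE /= neq_ltn => /orP[lt|lt]; first by apply: dL; rewrite lt /=.
  by rewrite disjoint_sym; apply: dL; rewrite lt /=.
have [p' _] := part_function hP'.
have d'0 : (0 < d')%N by case/card_gt0P: V0 => v _; case: (p' v) => j; apply: leq_ltn_trans.
(* The vertices of discarded layers simply return to the rest of the graph. *)
have [|Bd [_ cBd LBd]] := @zero_sum_subset d' k L' lL' fL k3 d'0 _
    (fun j : 'I_C => index_vector P' (L j)) [set: 'I_C].
  move=> j _; have [[pmL _ _] _] := hL j (ltn_ord j).
  rewrite coord_sum_index //; have /dvdnP[t ->] := card_induced_pm kH pmL.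
  by exists t%:Z; rewrite mulnC PoszM.
set A := [set: 'I_C] :\: Bd in LBd.
have cA : (N + N <= #|A|)%N.
  have : (#|Bd| <= k)%N by apply: leq_trans (ltnW cBd) d'k.
  by rewrite cardsD setTI cardsT card_ord /C; move: #|Bd| => t; clear; lia.
pose LA := \bigcup_(j in A) L j.
have dLAZ : [disjoint LA & Z].
  rewrite disjoint_sym; apply: bigcup_disjoint => j _; rewrite disjoint_sym.
  by case: (hL j (ltn_ord j)).
pose W := Z :|: LA.
have cW : (#|W| <= b)%N.
  apply: leq_trans (leq_card_setU _ _).1 _; apply: leq_trans leb.
  apply: leq_add cZ (leq_trans _ leC); apply: leq_trans cL; apply: subset_leq_card.
  by apply/bigcupsP=> j _; apply: bigcup_sup.
have [|M3 [sM3 tM3 dM3W cU]] := @near_perfect_matching V H k m kH k3 cV hdeg W.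
  move=> B cB; apply: nonext; apply: leq_trans cB _.
  by rewrite leq_add2l leq_mul2l cW orbT.
(* Fewer than [d'] edges are given back, enlarging the uncovered set by at most [k * k] vertices, so
   that the index vector of the kept matching lies in [L']. *)
have [M4 [sM4 cM4 LM4]] := zero_sum_matching hP' lL' fL sM3.
have sM4H : M4 \subset H by apply: subset_trans sM4 sM3.
have tM4 : finset.trivIset M4 by apply: trivIsetS tM3.
have tM34 : finset.trivIset (M3 :\: M4) by apply: trivIsetS (subsetDl _ _) tM3.
have sM34 : M3 :\: M4 \subset H by apply: subset_trans (subsetDl _ _) sM3.
pose C34 := finset.cover (M3 :\: M4).
pose D := ~: (W :|: C34).
have C34E : C34 = finset.cover M3 :\: finset.cover M4 by apply: cover_setD.
have cD : (#|D| <= 2 * (k * k) * k.-1 + k * k)%N.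
  have sD : D \subset ~: (W :|: finset.cover M3) :|: finset.cover M4.
    have h (X Y T : {set V}) : ~: (T :|: (X :\: Y)) \subset ~: (T :|: X) :|: Y.
      by clear; set_solve.
    by rewrite /D C34E; apply: h.
  apply: leq_trans (subset_leq_card sD) _; apply: leq_trans (leq_card_setU _ _).1 _.
  apply: leq_add (ltnW cU) _; rewrite (matching_card kH sM4H tM4) leq_mul2r.
  by rewrite (leq_trans (ltnW cM4) d'k) orbT.
have dC34W : [disjoint C34 & W].
  by rewrite C34E; apply: disjointWl dM3W; apply: subsetDl.
have eZ : ~: Z = LA :|: (C34 :|: D).
  have h (X Y T : {set V}) : [disjoint Y & T] -> [disjoint X & T :|: Y] ->
      ~: T = Y :|: (X :|: ~: (T :|: Y :|: X)).
    by clear; move=> ? ?; set_solve.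
  exact: h.
have dLC : [disjoint LA & C34 :|: D].
  have h (X Y T : {set V}) : [disjoint X & T :|: Y] ->
      [disjoint Y & X :|: ~: (T :|: Y :|: X)].
    by clear; move=> ?; set_solve.
  exact: h.
have dCD : [disjoint C34 & D].
  by rewrite disjoints_subset setCK subsetUr.
have eV : [set: V] = Z :|: (C34 :|: (D :|: LA)).
  by rewrite -(setUCr Z) eZ [D :|: LA]setUC [C34 :|: (LA :|: _)]setUCA.
(* The complement of the solution [M1] splits into [LA], [C34] and [D]; the whole and the first two
   have index vectors in [L']. *)
have LD : L' (index_vector P' D).
  have e : index_vector P' (~: Z) =
      index_vector P' LA + (index_vector P' C34 + index_vector P' D).
    by rewrite eZ !index_vectorU.
  have -> : index_vector P' D =
      index_vector P' (~: Z) - (index_vector P' LA + index_vector P' C34).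
    by apply/rowP=> j; move/rowP: e => /(_ j); rewrite !mxE; clear; lia.
  apply: (proj2 lL' _ _ LM1); apply: (is_latticeD lL').
    by rewrite index_vector_bigcup.
  by rewrite index_vector_cover.
have [xs [ys [hxs hys sxs sys exy]]] : bounded_lists (robust_index_vectors k mu P H) N
    (index_vector P D).
  apply: hN; last exact: hiii.
    by move=> v; apply: robust_rvector.
  move=> j; rewrite mxE; apply/andP; split=> //.
  by apply: leq_trans cD; apply: subset_leq_card; apply: subsetIl.
have pmDL : pm (D :|: LA).
  apply: (@layers_absorb V H k k3 d P hP _ A L l xs ys D) => //.
  - by move=> j1 j2 _ _; apply: dLj.
  - move=> j jA; have [lj _] := hL j (ltn_ord j); split=> //.
    have sj : L j \subset W.
      by apply: subset_trans (subsetUr _ _); apply: (bigcup_sup j).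
    by apply: disjointWr sj _; rewrite disjoint_sym disjoints_subset setCK subsetUl.
  - by move=> v /hxs/hl.
  - by move=> v /hys/hl.
  - by move=> v /hl; apply: robust_rvector.
  - by apply: leq_trans cA; apply: leq_add.
apply: has_pmE; rewrite eV; apply: induced_pmU; last 1 first.
- apply: induced_pmU => //; last exact: matching_pm.
  apply/disjointP=> x xC; rewrite inE (disjointFr dCD xC) /=.
  by apply/negP=> xL; have := disjointFr dC34W xC; rewrite inE xL orbT.
- by rewrite [D :|: LA]setUC [C34 :|: _]setUCA -eZ disjoints_subset setCK.
- exact: matching_pm.
Qed.

End Final.

(** * Choice of the constants *)

Lemma sum_card_parts (V : finType) d (P : d.-tuple {set V}) :
  ordered_partition P -> (\sum_j #|tnth P j|)%N = #|V|.
Proof.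
move=> hP; apply/eqP; rewrite -eqz_nat -cardsT -(coord_sum_index [set: V] hP) /coord_sum.
apply/eqP; rewrite (big_morph Posz PoszD (erefl _)); apply: eq_bigr => j _.
by rewrite mxE setTI.
Qed.

(** The bound on [gamma] makes [n / k - 2 * gamma * n] exceed [n / (k + 1)], so [k + 1] parts would
    not fit. This limits the dimension for the fine partition, as the full pair does for the coarse
    one. *)
Lemma large_parts_few (R : realType) (V : finType) d (P : d.-tuple {set V}) (k : nat)
    (gamma : R) :
  (0 < k)%N -> (0 < #|V|)%N -> gamma < (2 * k%:R * k.+1%:R)^-1 ->
  ordered_partition P ->
  (forall j, #|V|%:R / k%:R - 2 * gamma * #|V|%:R <= #|tnth P j|%:R) -> (d <= k)%N.
Proof.
move=> k0 V0 hg hP hj; rewrite leqNgt; apply/negP=> lt.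
have kR : 0 < k%:R :> R by rewrite ltr0n.
have VR : 0 < #|V|%:R :> R by rewrite ltr0n.
set x : R := #|V|%:R / k%:R - 2 * gamma * #|V|%:R in hj.
have hx : #|V|%:R < k.+1%:R * x.
  have k1R : 0 < k.+1%:R :> R by rewrite ltr0n.
  have : 2 * gamma * k.+1%:R < k%:R^-1.
    move: hg; rewrite -div1r ltr_pdivlMr ?mulr_gt0 // => hg.
    by rewrite -div1r ltr_pdivlMr //; apply: le_lt_trans hg; rewrite le_eqVlt; apply/orP; left; apply/eqP; ring.
  rewrite -(ltr_pM2r VR) /x => h.
  have -> : k.+1%:R * (#|V|%:R / k%:R - 2 * gamma * #|V|%:R) =
      #|V|%:R + k%:R^-1 * #|V|%:R - 2 * gamma * k.+1%:R * #|V|%:R.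
    by rewrite -natr1; field; rewrite gt_eqF.
  by rewrite -addrA ltrDl subr_gt0.
have x0 : 0 < x by rewrite -(pmulr_rgt0 _ (_ : 0 < k.+1%:R)) ?ltr0n //; apply: lt_trans hx.
have : d%:R * x <= #|V|%:R.
  rewrite -(sum_card_parts hP) natr_sum -[d in d%:R]card_ord mulr_natl -sumr_const.
  exact: ler_sum.
apply/negP; rewrite -ltNge; apply: lt_le_trans hx _.
by rewrite ler_pM2r // ler_nat.
Qed.

Theorem theorem2p6 (R : realType) (k : nat) (hk : (3 <= k)%N) :
  exists gamma0 : R, 0 < gamma0 /\
  forall gamma : R, 0 < gamma < gamma0 ->
  exists beta0 mu0 : R, [/\ 0 < beta0, 0 < mu0 &
  forall beta mu : R, 0 < beta < beta0 -> 0 < mu < mu0 ->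
  exists n0 : nat,
  forall n : nat, (n0 <= n)%N -> (k %| n)%N ->
  forall (V : finType) (H : {set {set V}}),
    #|V| = n -> kgraph k H ->
    n%:R / k%:R <= (min_codegree k H)%:R :> R ->
  forall (d d' : nat) (P0 : d.-tuple {set V}) (P0' : d'.-tuple {set V}),
    ordered_partition P0 -> ordered_partition P0' ->
    refines P0 P0' /\ full_pair k P0' (robust_lattice k mu P0' H) ->
    (forall i : 'I_d, n%:R / k%:R - 2 * gamma * n%:R <= #|tnth P0 i|%:R) /\
    (forall j : 'I_d', n%:R / k%:R - 2 * gamma * n%:R <= #|tnth P0' j|%:R) ->
    (forall D : {set V},
       robust_lattice k mu P0' H (index_vector P0' D) ->
       robust_lattice k mu P0 H (index_vector P0 D)) ->
    (forall i : 'I_d, closed_in k H beta (2 ^ (k - 1)) (tnth P0 i)) ->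
    has_perfect_matching H <->
    soluble H P0' (robust_lattice k mu P0' H) /\ ~ parity_family k H].
Proof.
have k0 : (0 < k)%N by apply: ltnW (ltnW hk).
have kR : 0 < k%:R :> R by rewrite ltr0n.
exists (2 * k%:R * k.+1%:R)^-1; split; first by rewrite invr_gt0 !mulr_gt0 // ltr0n.
move=> gamma /andP[_ hgamma]; exists 1, 1; split=> // beta mu hbeta /andP[mu0 _].
have /andP[beta0 beta1] := hbeta.
set i := (2 ^ (k - 1))%N; have i0 : (0 < i)%N by rewrite expn_gt0.
set gs := (k + k * (i * k - 1))%N.
set cD := (2 * (k * k) * k.-1 + k * k)%N.
(* The number of parts is only known later, so [N] is taken uniform over all [d <= k]. *)
have [NN hNN] := fin_all_exists (fun d : 'I_k.+1 => bounded_representation k cD d).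
pose N := \max_d NN d.
have hN d : (d <= k)%N -> forall I : 'rV[int]_d -> Prop, (forall v, I v -> rvector k v) ->
    forall v : 'rV[int]_d, (forall j, 0 <= v 0 j <= cD%:Z) ->
    lattice_generated I v -> bounded_lists I N v.
  rewrite -ltnS => dk I hI v hv gv.
  have [xs [ys [hxs hys sxs sys e]]] := hNN (Ordinal dk) I hI v hv gv.
  have le : (NN (Ordinal dk) <= N)%N by apply: leq_bigmax.
  by exists xs, ys; split=> //; [exact: leq_trans sxs le | exact: leq_trans sys le].
set C := (2 * N + k)%N; set tau := (k.+1 ^ k)%N.
(* With [r = (k + 1) * (n %/ (2 * Q * K))], the layers use at most [K * (n %/ (2 * Q * K))] vertices
   in gadgets, half of [b = n %/ Q]; the vertices of the solution and the released edges, bounded by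
   [c0] below, fit in the other half. *)
pose K := (C * tau * k.+1 * gs)%N.
have K0 : (0 < K)%N by rewrite !muln_gt0 expn_gt0 !addn_gt0 k0 orbT.
(* The three summands give [4 * b <= beta * n] for the gadgets, [b < mu * n] for the availability of
   edges, and [60 * k^3 * b <= m] for the extremal case. *)
pose Q := (Num.bound (4 / beta) + Num.bound mu^-1 + 60 * (k * k * k * k))%N.
have Q0 : (0 < Q)%N by rewrite addn_gt0 !muln_gt0 k0 orbT.
have hc : 0 < 1 - (beta / 2) ^+ k < 1.
  have h : 0 < beta / 2 < 1 by apply/andP; split; lra.
  rewrite subr_gt0 ltrBlDr ltrDl; have /andP[h0 h1] := h.
  by rewrite exprn_gt0 // andbT exprn_ilt1 // ?ltW // -lt0n.
have QK0 : (0 < Q * (2 * K))%N by rewrite muln_gt0 Q0 muln_gt0 K0.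
have [n1 hn1] := exp_beats_power k hc QK0.
pose c0 := (k * k + C * (tau * k))%N.
exists (n1 + Q * (2 * c0 + gs + k).+1)%N => n ln kn V H cV kH.
rewrite -cV in ln kn * => hcod d d' P0 P0' hP hP' [_ [_ d'k _ fL]] [hd _] hiii hcl.
have n0 : (0 < #|V|)%N.
  apply: leq_trans ln; apply: leq_trans (leq_addl _ _).
  by rewrite muln_gt0 Q0.
have dk : (d <= k)%N := large_parts_few k0 n0 hgamma hP hd.
have [m hm] : exists m, #|V| = (k * m)%N.
  by case/dvdnP: kn => m ->; exists m; rewrite mulnC.
have hdeg (S : {set V}) : #|S| = k.-1 -> (m <= #|nbr H S|)%N.
  move=> cS; rewrite (card_nbr kH k0 cS); apply: leq_trans (min_codegree_le H cS).
  by move: hcod; rewrite hm natrM mulrC mulKf ?gt_eqF // ler_nat.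
have lL' : is_lattice (robust_lattice k mu P0' H) by apply: lattice_generated_is_lattice.
split=> [pmH|[sol hpar]].
  split; last exact: perfect_matching_parity kH hk pmH.
  by apply: (perfect_matching_soluble (k := k)).
set b := (#|V| %/ Q)%N.
have lb : (2 * c0 + gs + k < b)%N.
  rewrite /b leq_divRL // mulnC; apply: leq_trans ln; apply: leq_addl.
have bQ : (b * Q <= #|V|)%N by apply: leq_trunc_div.
have b0 : (0 < b)%N by apply: leq_trans lb.
have bQR : b%:R * Q%:R <= #|V|%:R :> R by rewrite -natrM ler_nat.
set r := (k.+1 * (#|V| %/ (Q * (2 * K))))%N.
have bR : 0 < b%:R :> R by rewrite ltr0n.
have hQ1 : 4 / beta <= Q%:R.
  apply: le_trans (ltW (archi_boundP _)) _; first by rewrite divr_ge0 // ltW.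
  by rewrite ler_nat /Q -addnA leq_addr.
have hQ2 : mu^-1 < Q%:R.
  apply: lt_le_trans (archi_boundP _) _; first by rewrite invr_ge0 ltW.
  by rewrite ler_nat /Q addnAC leq_addl.
apply: (soluble_perfect_matching (b := b) (r := r) kH hk n0 i0 hbeta mu0 hm hdeg hP hP' dk d'k fL hiii hcl (hN d dk)) => //.
- have lK : (2 * (K * (#|V| %/ (Q * (2 * K)))) <= b)%N.
    by rewrite divnMA mulnA mulnC; apply: leq_trunc_div.
  have ar (x y z u w : nat) : (w + x * (y * (k.+1 * u * z + k)) =
      w + x * (y * k) + x * y * k.+1 * z * u)%N by clear; lia.
  rewrite -/gs -/tau -/C /r ar -/c0 -/K.
  have fin (p q s t v : nat) : (2 * p + s + t < v -> 2 * q <= v -> p + q <= v)%N.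
    by clear; lia.
  exact: fin lb lK.
- apply: (@le_trans _ _ (4 * b%:R)).
    have fin (p s t v : nat) : (2 * p + s + t < v -> 2 * (v + s + t) <= 4 * v)%N.
      by clear; lia.
    by rewrite -!natrM ler_nat; exact: fin lb.
  rewrite mulrC -ler_pdivrMl //; apply: le_trans bQR.
  by rewrite mulrCA ler_pM2l // mulrC.
- rewrite mulrC -ltr_pdivrMr //; apply: lt_le_trans bQR.
  by rewrite ltr_pM2l.
- by apply: hn1; apply: leq_trans ln; apply: leq_addr.
- have : (k * (60 * (k * k * k) * b) <= k * m)%N.
    rewrite -hm; apply: leq_trans bQ; rewrite /Q mulnDr.
    apply: leq_trans (leq_addl _ _); rewrite leq_eqVlt; apply/orP; left; apply/eqP.
    by ring.
  rewrite leq_pmul2l //; apply: leq_trans.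
  have ar (v : nat) : (0 < v)%N -> (20 * (k * k) * (2 * k * v).+1 <= 60 * (k * k * k) * v)%N.
    move=> v0; have : (k * k * 1 <= k * k * (k * v))%N by rewrite leq_mul2l muln_gt0 k0 v0 orbT.
    by clear; lia.
  exact: ar.
Qed.
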